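(* Let $f,u_\Omega\in L^2(\Omega)$. The optimal control problem: minimize $J(u,q)$ over all $(u,q)\in\tilde H^s(\Omega)\times\mathbb{Q}_{ad}$ satisfying the state equation $$\mathcal{A}(u,v)+(qu,v)_{L^2(\Omega)}=(f,v)_{L^2(\Omega)}\qquad\forall v\in\tilde H^s(\Omega),$$ admits at least one global solution $(\bar u,\bar q)\in\tilde H^s(\Omega)\times\mathbb{Q}_{ad}$.
   Context: Setting: $d\ge 2$, $\Omega\subset\mathbb{R}^d$ is an open and bounded domain with Lipschitz boundary, $s\in(0,1)$, $\lambda>0$, and $0<a<b$ are real numbers. $\tilde H^s(\Omega)=\{v|_\Omega: v\in H^s(\mathbb{R}^d),\ \mathrm{supp}\,v\subset\bar\Omega\}$ (functions are identified with their extension by zero to $\mathbb{R}^d$). The bilinear form of the integral fractional Laplacian is $$\mathcal{A}(v,w)=\frac{C(d,s)}{2}\int_{\mathbb{R}^d}\int_{\mathbb{R}^d}\frac{(v(x)-v(y))(w(x)-w(y))}{|x-y|^{d+2s}}\,dx\,dy,\qquad C(d,s)=\frac{2^{2s}s\,\Gamma(s+\frac d2)}{\pi^{d/2}\Gamma(1-s)}.$$ The cost functional is $J(u,q)=\frac12\|u-u_\Omega\|_{L^2(\Omega)}^2+\frac{\lambda}{2}\|q\|_{L^2(\Omega)}^2$ and the admissible set is $\mathbb{Q}_{ad}=\{v\in L^\infty(\Omega): a\le v(x)\le b \text{ for a.e. } x\in\Omega\}$. *)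

(* Defs.v *)
From HB Require Import structures.
From mathcomp Require Import all_boot all_order all_algebra.
From mathcomp Require Import all_classical all_reals all_analysis.

Set Implicit Arguments.
Unset Strict Implicit.
Unset Printing Implicit Defensive.

Import Order.TTheory GRing.Theory Num.Theory.
Import numFieldNormedType.Exports.

Local Open Scope classical_set_scope.
Local Open Scope ring_scope.

(* R^d is 'rV[R]_d with its library topology.  It receives the sigma-algebra
   generated by the coordinates, as the library does for d.-tuple R; by
   open_measurable_rV below, the open sets belong to it. *)

Definition rV_display : measure_display -> measure_display.
Proof. exact. Qed.

Section measurable_rV.
Context {disp : measure_display} {T : measurableType disp}.
Variable n : nat.

Let coor (i : 'I_n) (x : 'rV[T]_n) : T := x ord0 i.

Let rV_measurable0 : g_sigma_preimage coor set0.
Proof. exact: sigma_algebra0. Qed.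

Let rV_measurableC A : g_sigma_preimage coor A -> g_sigma_preimage coor (~` A).
Proof. exact: sigma_algebraC. Qed.

Let rV_bigcup (F : _^nat) : (forall i, g_sigma_preimage coor (F i)) ->
  g_sigma_preimage coor (\bigcup_i (F i)).
Proof. exact: sigma_algebra_bigcup. Qed.

HB.instance Definition _ := @isMeasurable.Build (rV_display disp)
  'rV[T]_n (g_sigma_preimage coor) rV_measurable0 rV_measurableC rV_bigcup.

Lemma measurable_coor (i : 'I_n) : measurable_fun [set: 'rV[T]_n] (coor i).
Proof.
move=> _ Y mY; rewrite setTI; apply: sub_sigma_algebra => /=.
rewrite -bigcup_seq/=; exists i => /=; first by rewrite mem_index_enum.
by exists Y => //; rewrite setTI.
Qed.

Lemma measurable_fun_rVP d1 (T1 : measurableType d1) (f : T1 -> 'rV[T]_n) :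
  (forall i, measurable_fun [set: T1] (fun x => f x ord0 i)) ->
  measurable_fun [set: T1] f.
Proof.
move=> mf.
have : g_sigma_preimage (fun i => coor i \o f) `<=` measurable.
  apply: smallest_sub; first exact: sigma_algebra_measurable.
  rewrite -bigcup_seq; apply: bigcup_sub => i _ A [B mB <-]; exact: mf.
by rewrite g_sigma_preimage_comp => prefS _ A mA; apply: prefS; exists A.
Qed.

End measurable_rV.

Section lebesgue_measure_rV.
Variable R : realType.
Local Open Scope ereal_scope.

Definition rV_cons n (p : measurableTypeR R * 'rV[R]_n) : 'rV[R]_n.+1 :=
  \row_i oapp (p.2 ord0) p.1 (unlift ord0 i).

Lemma rV_cons0 n (p : measurableTypeR R * 'rV[R]_n) : rV_cons p ord0 ord0 = p.1.
Proof. by rewrite mxE unlift_none. Qed.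

Lemma rV_consS n (p : measurableTypeR R * 'rV[R]_n) j :
  rV_cons p ord0 (lift ord0 j) = p.2 ord0 j.
Proof. by rewrite mxE liftK. Qed.

Lemma measurable_rV_cons n : measurable_fun [set: measurableTypeR R * 'rV[R]_n] (@rV_cons n).
Proof.
apply: measurable_fun_rVP => i; case: (unliftP ord0 i) => [j|] ->.
  rewrite (_ : (fun _ => _) = (fun y : 'rV[R]_n => y ord0 j) \o snd).
    exact: (measurableT_comp (measurable_coor j)).
  by apply/funext => p /=; rewrite rV_consS.
rewrite (_ : (fun _ => _) = fst) //.
by apply/funext => p /=; rewrite rV_cons0.
Qed.

Section step.
Variables (n : nat) (mu : {sigma_finite_measure set 'rV[R]_n -> \bar R}).

Definition lebesgue_rV_step : set 'rV[R]_n.+1 -> \bar R :=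
  pushforward ((@lebesgue_measure R) \x mu) (@rV_cons n).

Let mpre A : measurable A -> measurable (@rV_cons n @^-1` A).
Proof. by move=> mA; rewrite -[X in measurable X]setTI; exact: measurable_rV_cons. Qed.

Let step0 : lebesgue_rV_step set0 = 0.
Proof. by rewrite /lebesgue_rV_step /pushforward preimage_set0 measure0. Qed.

Let step_ge0 A : 0 <= lebesgue_rV_step A.
Proof. by rewrite /lebesgue_rV_step /pushforward measure_ge0. Qed.

Let step_sigma_additive : semi_sigma_additive lebesgue_rV_step.
Proof.
move=> F mF tF mUF; rewrite /lebesgue_rV_step /pushforward preimage_bigcup.
apply: measure_semi_sigma_additive.
- by move=> k; exact: mpre.
- apply/trivIsetP => /= i j _ _ ij; rewrite -preimage_setI.
  by move/trivIsetP : tF => /(_ _ _ _ _ ij) ->//; rewrite preimage_set0.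
- by rewrite -preimage_bigcup; exact: mpre.
Qed.

HB.instance Definition _ := isMeasure.Build _ _ _ lebesgue_rV_step
  step0 step_ge0 step_sigma_additive.

Let rV_consK : cancel (@rV_cons n)
  (fun x => (x ord0 ord0, \row_j x ord0 (lift ord0 j))).
Proof.
move=> [t y]; rewrite rV_cons0; congr pair.
by apply/rowP => j; rewrite mxE rV_consS.
Qed.

Let step_sigma_finite : sigma_finite setT lebesgue_rV_step.
Proof.
have /sigma_finiteP[F [UF ndF Foo]] := sigma_finiteT (@lebesgue_measure R).
have /sigma_finiteP[G [UG ndG Goo]] := sigma_finiteT mu.
pose g (x : 'rV[R]_n.+1) : measurableTypeR R * 'rV[R]_n :=
  (x ord0 ord0, \row_j x ord0 (lift ord0 j)).
have mg : measurable_fun [set: 'rV[R]_n.+1] g.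
  apply: measurable_fun_pair; first exact: measurable_coor.
  apply: measurable_fun_rVP => j.
  rewrite (_ : (fun _ => _) = fun x : 'rV[R]_n.+1 => x ord0 (lift ord0 j)).
    exact: measurable_coor.
  by apply/funext => x; rewrite mxE.
exists (fun k => g @^-1` (F k `*` G k)).
  apply/seteqP; split => // x _.
  have [k _ Fk] : (\bigcup_k F k) (g x).1 by rewrite -UF.
  have [l _ Gl] : (\bigcup_k G k) (g x).2 by rewrite -UG.
  exists (maxn k l) => //; split.
    by move: Fk; exact/subsetPset/ndF/leq_maxl.
  by move: Gl; exact/subsetPset/ndG/leq_maxr.
move=> k; have [mF Fk] := Foo k; have [mG Gk] := Goo k; split.
  by rewrite -[X in measurable X]setTI; apply: mg => //; exact: measurableX.
rewrite /lebesgue_rV_step /pushforward -comp_preimage.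
rewrite (_ : g \o _ = id) ?preimage_id; last exact/funext/rV_consK.
by rewrite product_measure1E// lte_mul_pinfty// ge0_fin_numE.
Qed.

HB.instance Definition _ := Measure_isSigmaFinite.Build _ _ _ lebesgue_rV_step
  step_sigma_finite.

End step.

(* d-dimensional Lebesgue measure, as an iterated product measure; see
   lebesgue_rV_box for its value on boxes. *)
Fixpoint lebesgue_rV n : {sigma_finite_measure set 'rV[R]_n -> \bar R} :=
  match n with
  | 0 => \d_(0%R : 'rV[R]_0)
  | m.+1 => lebesgue_rV_step (lebesgue_rV m)
  end.

Lemma measurable_rV_box n (I : 'I_n -> interval R) :
  measurable [set x : 'rV[R]_n | forall i, x ord0 i \in I i].
Proof.
rewrite (_ : mkset _ = \big[setI/setT]_(i < n)
    ((fun x : 'rV[R]_n => x ord0 i) @^-1` [set` I i])).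
  apply: bigsetI_measurable => i _; rewrite -[X in measurable X]setTI.
  by apply: measurable_coor => //; exact: measurable_itv.
apply/seteqP; split => x; rewrite -bigcap_seq /=.
  by move=> xI i _; exact: xI.
by move=> xI i; exact: (xI i (mem_index_enum i)).
Qed.

Lemma lebesgue_rV_box n (I : 'I_n -> interval R) :
  lebesgue_rV n [set x | forall i, x ord0 i \in I i] =
  \prod_(i < n) lebesgue_measure [set` I i].
Proof.
elim: n => [|n ih] in I *.
  by rewrite big_ord0 /= diracE mem_set// => -[].
rewrite big_ord_recl -ih/= /lebesgue_rV_step /pushforward.
rewrite -product_measure1E//; last first.
  exact: measurable_rV_box.
congr product_measure1; apply/seteqP; split => -[t y] /=.
  move=> tyI; split => [|i].
    by have := tyI ord0; rewrite rV_cons0.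
  by have := tyI (lift ord0 i); rewrite rV_consS.
move=> [tI yI] i; case: (unliftP ord0 i) => [j|] ->.
  by rewrite rV_consS; exact: yI.
by rewrite rV_cons0.
Qed.

End lebesgue_measure_rV.

Lemma open_measurable_rV (R : realType) n (A : set 'rV[R]_n) :
  open A -> measurable A.
Proof.
move=> oA; pose box (pq : 'rV[rat]_n * 'rV[rat]_n) : set 'rV[R]_n :=
  [set x | forall i, x ord0 i \in `]ratr (pq.1 ord0 i), ratr (pq.2 ord0 i)[].
rewrite (_ : A = \bigcup_pq (if `[< box pq `<=` A >] then box pq else set0)).
  apply: countable_bigcupT_measurable => // pq; case: ifP => // _.
  exact: measurable_rV_box.
apply/seteqP; split => [x Ax|x [pq _]]; last first.
  by case: ifPn => // /asboolP boxA /boxA.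
have /nbhs_ballP[e /= e0 xeA] : nbhs x A by exact: open_nbhs_nbhs.
have /choice[p xp] i : exists p, ratr p \in `](x ord0 i - e), (x ord0 i)[.
  by apply: rat_in_itvoo; rewrite ltrBlDr ltrDl.
have /choice[q xq] i : exists q, ratr q \in `](x ord0 i), (x ord0 i + e)[.
  by apply: rat_in_itvoo; rewrite ltrDl.
exists (\row_i p i, \row_i q i) => //; case: ifPn => [_|/asboolP[y yb]].
  move=> i /=; rewrite !mxE in_itv/=.
  by move: (xp i) (xq i); rewrite !in_itv/= => /andP[_ ->] /andP[->].
apply: xeA; split => // i0 i; rewrite (ord1 i0) /ball/= ltr_distlC.
move: (yb i) (xp i) (xq i); rewrite /= !mxE !in_itv/=.
move=> /andP[py yq] /andP[xp1 _] /andP[_ xq2].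
by rewrite (lt_trans xp1 py) (lt_trans yq xq2).
Qed.

Section function_spaces.
Variables (R : realType) (d : nat).
Local Notation Rd := 'rV[R]_d.
Local Notation leb := (@lebesgue_rV R d).
Implicit Types (Omega : set Rd) (u v w f g q : Rd -> R) (s lambda a b : R).

(* The library norm on 'rV[R]_d is the max norm. *)
Definition eucl_norm (x : Rd) : R := Num.sqrt (\sum_(i < d) x ord0 i ^+ 2).

Definition boundary Omega : set Rd := closure Omega `\` Omega°.

(* Near each boundary point, in suitable orthonormal coordinates, Omega is the
   set of points strictly below the graph of a Lipschitz function of the d - 1
   coordinates other than the k-th. *)
Definition lipschitz_boundary Omega := forall x0, boundary Omega x0 ->
  exists (Q : 'M[R]_d) (k : 'I_d) (gamma : 'rV[R]_d.-1 -> R),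
    [/\ Q *m Q^T = 1%:M, lipschitz gamma &
        \forall x \near x0,
          Omega x <-> (x *m Q) ord0 k < gamma (col' k (x *m Q))].

Definition domain Omega := [/\ open Omega, connected Omega & Omega !=set0].

(* Elements of function spaces on Omega are represented by functions on Rd, of
   which only the values in Omega matter. *)
Definition Lp Omega (p : \bar R) : set (Rd -> R) :=
  [set f | f \_ Omega \in Lfun leb p].

Definition L2norm Omega f : R := fine ('N[leb]_2%:E [EFin \o f \_ Omega]).

Definition L2inner Omega f g : R := \int[leb]_(x in Omega) (f x * g x).

(* H^s(R^d), 0 < s < 1, with the Sobolev-Slobodeckij (Gagliardo) seminorm. *)
Definition gagliardo s v : \bar R :=
  (\int[(leb \x leb)%E]_z
    ((v z.1 - v z.2) ^+ 2 / eucl_norm (z.1 - z.2) `^ (d%:R + 2 * s))%:E)%E.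

Definition Hs s : set (Rd -> R) :=
  [set v | v \in Lfun leb 2%:E /\ (gagliardo s v < +oo)%E].

(* Support of an a.e. class: complement of the largest open set on which v
   vanishes a.e. *)
Definition ae_support v : set Rd :=
  ~` \bigcup_(U in [set U | open U /\ {ae leb, forall x, U x -> v x = 0}]) U.

(* Restrictions to Omega, identified with their extensions by zero. *)
Definition Hs_tilde Omega s : set (Rd -> R) :=
  [set v \_ Omega | v in [set v | Hs s v /\ ae_support v `<=` closure Omega]].

Definition Gamma (x : R) : R :=
  \int[@lebesgue_measure R]_(t in `]0, +oo[) (t `^ (x - 1) * expR (- t)).

Definition frac_lap_cst s : R :=
  (2 `^ (2 * s) * s * Gamma (s + d%:R / 2)) /
  (pi `^ (d%:R / 2) * Gamma (1 - s)).

Definition frac_lap_form s v w : R :=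
  frac_lap_cst s / 2 * \int[(leb \x leb)%E]_z
    ((v z.1 - v z.2) * (w z.1 - w z.2) /
     eucl_norm (z.1 - z.2) `^ (d%:R + 2 * s)).

Definition admissible_controls Omega a b : set (Rd -> R) :=
  [set q | Lp Omega +oo%E q /\
           {ae leb, forall x, Omega x -> a <= q x <= b}].

Definition cost Omega lambda uOmega u q : R :=
  2^-1 * L2norm Omega (u \- uOmega) ^+ 2 + lambda / 2 * L2norm Omega q ^+ 2.

Definition state_equation Omega s f u q := forall v, Hs_tilde Omega s v ->
  frac_lap_form s u v + L2inner Omega (q \* u) v = L2inner Omega f v.

Definition feasible Omega s a b f u q :=
  [/\ Hs_tilde Omega s u, admissible_controls Omega a b q &
      state_equation Omega s f u q].

Definition global_solution Omega s lambda a b f uOmega u q :=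
  feasible Omega s a b f u q /\
  forall u' q', feasible Omega s a b f u' q' ->
    cost Omega lambda uOmega u q <= cost Omega lambda uOmega u' q'.

End function_spaces.

(* Main.v *)
(* Minimising sequences (u_n, q_n) are bounded in H^s x L^2, and a subsequence of
   the states converges strongly in L^2: on a cube A of side h, the identity
     2 |A| int_A w^2 = 2 (int_A w)^2 + int_A int_A (w(x) - w(y))^2 dx dy
   bounds the L^2 norm of w by finitely many means plus C h^(2 s) times the
   Gagliardo seminorm, and along an ultrafilter all the means converge.  Let v be
   the limit of the states.  No weak topology is then needed: the pairs (U, Q)
   that satisfy the box constraints, are 8^-n-close to v, have cost at most
   inf J + 8^-n and solve, up to an error of order 8^-(n/2), the state equation
   with Q U replaced by Q v form nested convex sets that contain (u_n, q_n).
   Elements of nearly minimal norm in these sets form a Cauchy sequence by the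
   parallelogram law, and its strong limit is a global solution.  The same law
   yields a first feasible pair by minimising the energy for the control q = a.
   The Lipschitz boundary matters only through being null, which makes the space
   of the state equation complete: a piece of a graph has infinitely many disjoint
   translates in a bounded set. *)

From HB Require Import structures.
Require Import Defs.
From mathcomp Require Import all_boot all_order all_algebra.
From mathcomp Require Import all_classical all_reals all_analysis.
From mathcomp Require Import measurable_realfun ess_sup_inf.
From mathcomp Require Import ring lra.

Set Implicit Arguments.
Unset Strict Implicit.
Unset Printing Implicit Defensive.

Import Order.TTheory GRing.Theory Num.Theory.
Import numFieldNormedType.Exports.

Local Open Scope classical_set_scope.
Local Open Scope ring_scope.

(** * Near-minimisers of convex problems *)

(** The obstacle is the product of control and state: it makes the solution set of the state
    equation non-convex, and a bounded sequence of controls need not have a strong limit. Strong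
    convergence of the states lets the product be frozen at their limit [v], at the price of the
    residual [(q_n (v - u_n), w)] for a test function [w]; the bound [b] on the controls keeps it
    below [b 8^(-n/2)] times the norm of [w]. Limits have to be actual functions, not classes. The
    rate [8^-n] for squared distances is made for this: weighted by [4^n], the squared steps still
    have summable integrals, which forces convergence almost everywhere and so lets dominated
    convergence handle the products with the controls. A single semi-inner product [ip] carries the
    geometry: on R^d it gives the L^2 norm, on R^d x R^d, through [gd], the Gagliardo seminorm. *)

Section minimising_sequences.
Variables (R : realType) (T : Type).

(* Both the Lax-Milgram step (constant [C]) and the passage from weak to strong
   limits by convex combinations (shrinking [C], as in Mazur's lemma) rest on
   this: near-minimisers of [Q] on nested sets closed under midpoints are
   Cauchy for the parallelogram defect of [Q]. *)
Lemma nested_minimisers (C : nat -> set T) (mid : T -> T -> T) (Q : T -> R)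
    (lo hi : R) (e : nat -> R) :
  (forall n m, (n <= m)%N -> C m `<=` C n) ->
  (forall n x y, C n x -> C n y -> C n (mid x y)) ->
  (forall n x, C n x -> lo <= Q x) ->
  (forall n, exists2 x, C n x & Q x <= hi) ->
  (forall n, 0 < e n) -> (forall n m, (n <= m)%N -> e m <= e n) ->
  exists (x : nat -> T) (l : R),
    [/\ forall n, C n (x n),
        forall n m, (n <= m)%N ->
          2 * Q (x n) + 2 * Q (x m) - 4 * Q (mid (x n) (x m)) <= 8 * e n,
        forall n, Q (x n) <= l + e n &
        forall n, exists2 m, (n <= m)%N & forall y, C m y -> l - e n <= Q y].
Proof.
move=> nestC midC loQ hiQ e0 ndec.
(* The infima of [Q] over the shrinking sets [C n] increase; [sup S] is their limit. *)
pose S := [set t | exists n, forall y, C n y -> t <= Q y].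
have S0 : S !=set0 by exists lo, 0%N => y; exact: loQ.
have ubS : has_ubound S.
  by exists hi => t [n tQ]; have [x Cx xhi] := hiQ n; exact: le_trans (tQ _ Cx) xhi.
pose l := sup S.
(* The near-minimiser is taken in a later set [C m], where [Q] is already at least [l - e n]. One
   below [l + e n] exists there, since otherwise [l + e n] would belong to [S]. *)
have step n : exists mx : nat * T, [/\ (n <= mx.1)%N, C mx.1 mx.2,
    Q mx.2 <= l + e n & forall y, C mx.1 y -> l - e n <= Q y].
  have [t [k tQ] lt] := sup_adherent (e0 n) (conj S0 ubS).
  pose m := maxn n k.
  have Qm y : C m y -> l - e n <= Q y.
    move=> Cy; apply: (le_trans (ltW lt)); apply: tQ.
    by apply: nestC Cy; exact: leq_maxr.
  have [x Cx Qx] : exists2 x, C m x & Q x <= l + e n.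
    apply: contrapT => nex.
    have : S (l + e n).
      exists m => y Cy; rewrite leNgt; apply/negP => /ltW Qy.
      by apply: nex; exists y.
    by move/(ub_le_sup ubS); rewrite leNgt ltrDl e0.
  by exists (m, x); split => //; exact: leq_maxl.
have [mx mxP] := choice step.
exists (fun n => (mx n).2), l; split => [n|n m nm|n|n].
- by have [nm Cx _ _] := mxP n; exact: nestC Cx.
- have [nn Cn Qn ln] := mxP n; have [mm Cm Qm lm] := mxP m.
  have em := ndec _ _ nm.
  (* The midpoint lies in the larger of the two sets. The defect is then at most [2 (l + e n) + 2 (l
     + e m) - 4 (l - e n) <= 8 * e n]. *)
  have : l - e n <= Q (mid (mx n).2 (mx m).2).
    have [k1|k1] := leqP (mx n).1 (mx m).1.
      by apply: ln; apply: midC => //; exact: nestC Cm.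
    apply: (@le_trans _ _ (l - e m)); first by rewrite lerD2l lerN2.
    by apply: lm; apply: midC => //; apply: nestC Cn; exact: ltnW.
  lra.
- by have [] := mxP n.
- by have [nn _ _ ln] := mxP n; exists (mx n).1.
Qed.

End minimising_sequences.

(** * The inner product of square integrable functions *)

Section square_integrable.
Context {dT : measure_display} {T : measurableType dT} {R : realType}.
Variable mu : {measure set T -> \bar R}.
Implicit Types f g h : T -> R.

Definition sqint f := measurable_fun setT f /\
  (\int[mu]_x (f x ^+ 2)%:E < +oo)%E.

Definition ip f g : R := \int[mu]_x (f x * g x).

Lemma sqint_integrable f : sqint f -> mu.-integrable setT (fun x => (f x ^+ 2)%:E).
Proof.
move=> [mf foo]; apply/integrableP; split.
  by apply/measurable_EFinP; exact: measurable_funX.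
rewrite (le_lt_trans _ foo)//; apply: ge0_le_integral => //.
- apply: measurableT_comp => //.
  by apply/measurable_EFinP; exact: measurable_funX.
- by apply/measurable_EFinP; exact: measurable_funX.
- by move=> x _; rewrite gee0_abs// lee_fin sqr_ge0.
Qed.

Lemma sqint_mul f g : sqint f -> sqint g ->
  mu.-integrable setT (fun x => (f x * g x)%:E).
Proof.
move=> sf sg; have := integrableD measurableT (sqint_integrable sf) (sqint_integrable sg).
apply: le_integrable => //.
  by apply/measurable_EFinP; apply: measurable_funM; [case: sf|case: sg].
move=> x _ /=; rewrite lee_fin normrM [leRHS]ger0_norm ?addr_ge0 ?sqr_ge0//.
rewrite -(real_normK (num_real (f x))) -(real_normK (num_real (g x))).
have := sqr_ge0 (`|f x| - `|g x|); have := normr_ge0 (f x); have := normr_ge0 (g x).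
nra.
Qed.

Lemma sqint_le f g : measurable_fun setT f -> (forall x, `|f x| <= `|g x|) ->
  sqint g -> sqint f.
Proof.
move=> mf fg [mg goo]; split=> //; apply: le_lt_trans goo.
apply: ge0_le_integral => //.
- by move=> x _; rewrite lee_fin sqr_ge0.
- by apply/measurable_EFinP; exact: measurable_funX.
- by apply/measurable_EFinP; exact: measurable_funX.
move=> x _; rewrite lee_fin -(real_normK (num_real (f x))).
by rewrite -(real_normK (num_real (g x))) lerXn2r ?nnegrE.
Qed.

Lemma sqintZ a f : sqint f -> sqint (a *: f).
Proof.
move=> sf; have [mf foo] := sf; split; first exact: measurable_funM.
under eq_integral do rewrite /= [(_ *: _) _]/(_ * _) exprMn EFinM.
rewrite ge0_integralZl//.
- by rewrite lte_mul_pinfty// lee_fin sqr_ge0.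
- by apply/measurable_EFinP; exact: measurable_funX.
- by move=> x _; rewrite lee_fin sqr_ge0.
- by rewrite lee_fin sqr_ge0.
Qed.

Lemma sqintD f g : sqint f -> sqint g -> sqint (f + g).
Proof.
move=> sf sg; have [mf _] := sf; have [mg _] := sg.
split; first exact: measurable_funD.
(* The majorant [2 f^2 + 2 g^2] is written as a sum of two squares, whence the factors
   [Num.sqrt 2]. *)
have := integrableD measurableT (sqint_integrable (sqintZ (Num.sqrt 2) sf))
   (sqint_integrable (sqintZ (Num.sqrt 2) sg)).
move=> /integrableP[_]; apply: le_lt_trans; apply: ge0_le_integral => //.
- by move=> x _; rewrite lee_fin sqr_ge0.
- by apply/measurable_EFinP; apply: measurable_funX; exact: measurable_funD.
- apply: measurableT_comp => //; apply/measurable_EFinP; apply: measurable_funD;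
   apply: measurable_funX; exact: measurable_funM.
move=> x _; rewrite lee_fin /= !exprMn sqr_sqrtr// ger0_norm.
  have -> : (f + g) x = f x + g x by [].
  by have := sqr_ge0 (f x - g x); nra.
by rewrite addr_ge0// mulr_ge0// sqr_ge0.
Qed.

Lemma sqintN f : sqint f -> sqint (- f).
Proof. by rewrite -scaleN1r; exact: sqintZ. Qed.

Lemma sqintB f g : sqint f -> sqint g -> sqint (f - g).
Proof. by move=> sf sg; apply: sqintD => //; exact: sqintN. Qed.

Lemma ipC f g : ip f g = ip g f.
Proof. by congr fine; apply: eq_integral => x _; rewrite mulrC. Qed.

Lemma ipDl f g h : sqint f -> sqint g -> sqint h ->
  ip (f + g) h = ip f h + ip g h.
Proof.
move=> sf sg sh; rewrite /ip -RintegralD//; [|exact: sqint_mul..].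
by congr fine; apply: eq_integral => x _; rewrite mulrDl.
Qed.

Lemma ipZl a f h : sqint f -> sqint h -> ip (a *: f) h = a * ip f h.
Proof.
move=> sf sh; rewrite /ip -RintegralZl//; [|exact: sqint_mul].
by congr fine; apply: eq_integral => x _; rewrite mulrA.
Qed.

Lemma ipBl f g h : sqint f -> sqint g -> sqint h ->
  ip (f - g) h = ip f h - ip g h.
Proof.
move=> sf sg sh; rewrite ipDl//; last exact: sqintN.
by rewrite -scaleN1r ipZl// mulN1r.
Qed.

Lemma ipDr f g h : sqint f -> sqint g -> sqint h ->
  ip h (f + g) = ip h f + ip h g.
Proof. by move=> sf sg sh; rewrite ipC ipDl// !(ipC h). Qed.

Lemma ipZr a f h : sqint f -> sqint h -> ip h (a *: f) = a * ip h f.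
Proof. by move=> sf sh; rewrite ipC ipZl// ipC. Qed.

Lemma ipBr f g h : sqint f -> sqint g -> sqint h ->
  ip h (f - g) = ip h f - ip h g.
Proof. by move=> sf sg sh; rewrite ipC ipBl// !(ipC h). Qed.

Lemma ip_ge0 f : 0 <= ip f f.
Proof. by apply: Rintegral_ge0 => x _; rewrite -expr2 sqr_ge0. Qed.

Lemma EFin_ip f : sqint f -> (ip f f)%:E = (\int[mu]_x (f x ^+ 2)%:E)%E.
Proof.
by move=> sf; rewrite fineK//; exact: integrable_fin_num (sqint_integrable sf).
Qed.

Lemma ip_CS f g : sqint f -> sqint g -> ip f g ^+ 2 <= ip f f * ip g g.
Proof.
move=> sf sg.
have q t : 0 <= ip f f - 2 * t * ip f g + t ^+ 2 * ip g g.
  have := ip_ge0 (f - t *: g); have stg := sqintZ t sg.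
  rewrite ipBl ?ipBr ?ipZl ?ipZr//; last exact: sqintB.
  by rewrite (ipC g f); lra.
have [g0|g0] := eqVneq (ip g g) 0.
  rewrite g0 mulr0; rewrite real_leNgt ?num_real//; apply/negP => fg.
  have fg0 : ip f g != 0 by apply: contraTneq fg => ->; rewrite expr2 mul0r ltxx.
  (* For a null vector [g] the polynomial is affine in [t]; at this point it equals
     [- ip f f - 2 < 0]. *)
  have := q ((ip f f + 1) / ip f g); rewrite g0 mulr0 addr0 -mulrA divfK//.
  have := ip_ge0 f; lra.
have gp : 0 < ip g g by rewrite lt_def g0 ip_ge0.
have := q (ip f g / ip g g).
rewrite -(pmulr_rge0 _ gp); set A := ip f f; set B := ip f g; set C := ip g g.
have -> : C * (A - 2 * (B / C) * B + (B / C) ^+ 2 * C) = A * C - B ^+ 2.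
  by field.
by rewrite subr_ge0.
Qed.

Lemma ip_subr_le f g : sqint f -> sqint g ->
  ip (f - g) (f - g) <= 2 * ip f f + 2 * ip g g.
Proof.
move=> sf sg; have sB := sqintB sf sg; have sD := sqintD sf sg.
have := ip_ge0 (f + g).
rewrite (ipDl sf sg sD) (ipDr sf sg sf) (ipDr sf sg sg).
rewrite (ipBl sf sg sB) (ipBr sf sg sf) (ipBr sf sg sg).
by rewrite (ipC g f); lra.
Qed.

Lemma ip_le f g : sqint f -> sqint g -> (forall x, `|f x| <= `|g x|) ->
  ip f f <= ip g g.
Proof.
move=> sf sg fg; apply: le_Rintegral => //; [exact: sqint_mul..|].
move=> x _; rewrite -!expr2 -(real_normK (num_real (f x))).
by rewrite -(real_normK (num_real (g x))) lerXn2r ?nnegrE.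
Qed.

Lemma ip_parallelogram f g : sqint f -> sqint g ->
  2 * ip f f + 2 * ip g g
    - 4 * ip (2^-1 *: (f + g)) (2^-1 *: (f + g)) = ip (f - g) (f - g).
Proof.
move=> sf sg; have sB := sqintB sf sg; have sD := sqintD sf sg.
have sZ := sqintZ 2^-1 sD.
rewrite (ipZl _ sD sZ) (ipZr _ sD sD).
rewrite (ipDl sf sg sD) (ipDr sf sg sf) (ipDr sf sg sg).
rewrite (ipBl sf sg sB) (ipBr sf sg sf) (ipBr sf sg sg) (ipC g f).
by field.
Qed.

Lemma ip_mid_le f g c : sqint f -> sqint g ->
  ip f f <= c -> ip g g <= c ->
  ip (2^-1 *: (f + g)) (2^-1 *: (f + g)) <= c.
Proof.
move=> sf sg; have := ip_parallelogram sf sg; have := ip_ge0 (f - g); lra.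
Qed.

Lemma mid_subr f g h : 2^-1 *: (f + g) - h = 2^-1 *: ((f - h) + (g - h)).
Proof.
have H (x y z : R) : 2^-1 * (x + y) - z = 2^-1 * ((x - z) + (y - z)) by field.
by apply/funext => x; exact: H.
Qed.

End square_integrable.

(** * Completeness along fast Cauchy sequences *)

Section fast_convergence.
Variable R : realType.

Lemma cvgn_geometric_steps (u : nat -> R) (M : R) :
  (forall k, `|u k.+1 - u k| <= M * (2^-1) ^+ k) -> cvgn u.
Proof.
move=> uM; rewrite (funext (eq_sum_telescope u)).
apply: is_cvgD; first exact: is_cvg_cst.
apply: normed_cvg; apply: (@series_le_cvg _ _ (geometric M 2^-1)) => //=.
- by move=> n; exact: le_trans (uM n).
- by apply: is_cvg_geometric_series; rewrite ger0_norm ?invr_ge0// invf_lt1 ?ltr1n.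
Qed.

Lemma cvgn_weighted_steps (u : nat -> R) (M : R) :
  (forall k, 4 ^+ k * (u k.+1 - u k) ^+ 2 <= M) -> cvgn u.
Proof.
move=> uM; have M0 : 0 <= M.
  by apply: le_trans (uM 0%N); rewrite mulr_ge0 ?sqr_ge0.
(* The inequality [M <= (1 + M)^2] replaces a square root of [M]. *)
apply: (@cvgn_geometric_steps _ (1 + M)) => k.
have a0 : 0 <= (1 + M) * (2^-1) ^+ k.
  by rewrite mulr_ge0 ?addr_ge0// exprn_ge0// invr_ge0.
rewrite -(ger0_norm a0) -ler_sqr ?nnegrE// -!normrX !ger0_norm ?sqr_ge0//.
have k0 : (0 : R) < 4 ^+ k by rewrite exprn_gt0.
rewrite -(ler_pM2l k0); apply: le_trans (uM k) _.
rewrite exprMn -exprM mulrC mulrAC -mulrA.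
have -> : 4 ^+ k * 2^-1 ^+ (k * 2) = 1 :> R.
  by rewrite mulnC exprM -exprMn (_ : 4 * _ = 1) ?expr1n//; field.
rewrite mulr1; nra.
Qed.

Lemma nneseries_geometric_lty (a r : R) : 0 <= r < 1 ->
  (\sum_(k <oo) (a * r ^+ k)%:E < +oo)%E.
Proof.
move=> /andP[r0 r1].
have /cvg_lim -> // : (\sum_(0 <= k < n) (a * r ^+ k)%:E)%E @[n --> \oo]
    --> (a / (1 - r))%:E.
  under eq_fun do rewrite sumEFin.
  apply: cvg_EFin; first exact: nearW.
  by apply: (@cvg_geometric_series _ a r); rewrite ger0_norm.
exact: ltry.
Qed.

Lemma cvg_eighth : (8^-1 ^+ n : R) @[n --> \oo] --> 0.
Proof. by apply: cvg_expr; rewrite ger0_norm ?invr_ge0// invf_lt1 ?ltr1n. Qed.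

End fast_convergence.

Section pointwise_limits.
Context {dT : measure_display} {T : measurableType dT} {R : realType}.
Implicit Type f : nat -> T -> R.

(* A limit that is total and measurable whether or not [f] converges. *)
Definition llim f (x : T) : R := fine (limn_esup (fun n => (f n x)%:E)).

Lemma measurable_llim f : (forall n, measurable_fun setT (f n)) ->
  measurable_fun setT (llim f).
Proof.
move=> mf; apply: measurableT_comp => //.
by apply: measurable_fun_limn_esup => n; exact/measurable_EFinP.
Qed.

Lemma cvg_llim f x (l : R) : f n x @[n --> \oo] --> l -> llim f x = l.
Proof.
move=> fl; rewrite /llim.
have /cvg_limn_einf_sup[_ ->//] : (f n x)%:E @[n --> \oo] --> l%:E.
by apply: cvg_EFin => //; exact: nearW.
Qed.

(** A limit superior respects bounds even where the sequence diverges, so limit controls satisfy the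
    box constraints at every point and not only almost everywhere. *)
Lemma llim_itv f x (a b : R) : (forall n, a <= f n x <= b) ->
  a <= llim f x <= b.
Proof.
move=> hf; rewrite /llim.
have : (a%:E <= limn_esup (fun n => (f n x)%:E) <= b%:E)%E.
  rewrite limn_esup_lim; apply/andP; split.
    apply: lime_ge; first exact: is_cvg_esups.
    apply: nearW => n; apply: (@le_trans _ _ (f n x)%:E).
      by rewrite lee_fin; have /andP[] := hf n.
    by apply: ereal_sup_ubound; exists n => //=.
  apply: lime_le; first exact: is_cvg_esups.
  apply: nearW => n; apply: ge_ereal_sup => _ [k _ <-].
  by rewrite lee_fin; have /andP[] := hf k.
by case: limn_esup => [r| |]; rewrite ?lee_fin// => /andP[].
Qed.

End pointwise_limits.

Section square_integrable_limits.
Context {dT : measure_display} {T : measurableType dT} {R : realType}.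
Variable mu : {measure set T -> \bar R}.
Implicit Types (f : nat -> T -> R) (g : T -> R).

(** The series of [4^k (f_(k+1) - f_k)^2] has integral at most the sum of [4^k 8^-k = 2^-k]. It is
    therefore finite almost everywhere, and there the steps decay geometrically. *)
Lemma cvg_llim_ae f : (forall n, sqint mu (f n)) ->
  (forall n, ip mu (f n.+1 - f n) (f n.+1 - f n) <= 8^-1 ^+ n) ->
  {ae mu, forall x, f n x @[n --> \oo] --> llim f x}.
Proof.
move=> sf fC.
pose h k x := (4 ^+ k * (f k.+1 x - f k x) ^+ 2)%:E.
have h0 k x : (0 <= h k x)%E by rewrite lee_fin mulr_ge0 ?sqr_ge0// exprn_ge0.
have mB k : measurable_fun setT (fun x => f k.+1 x - f k x).
  by apply: measurable_funB; [have [] := sf k.+1|have [] := sf k].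
have mh k : measurable_fun setT (h k).
  by apply/measurable_EFinP; apply: measurable_funM => //; exact: measurable_funX.
have hint k : (\int[mu]_x h k x <= (2^-1 ^+ k)%:E)%E.
  have -> : (\int[mu]_x h k x =
      (4 ^+ k)%:E * \int[mu]_x (((f k.+1 - f k) x) ^+ 2)%:E)%E.
    rewrite -ge0_integralZl//.
    - by apply/measurable_EFinP; exact: (measurable_funX _ (mB k)).
    - by move=> x _; rewrite lee_fin sqr_ge0.
  rewrite -EFin_ip; last exact: sqintB.
  rewrite -EFinM lee_fin (_ : 2^-1 = 4 * 8^-1); last by field.
  by rewrite exprMn ler_wpM2l// exprn_ge0.
have sumoo : (\int[mu]_x (\sum_(k <oo) h k x) < +oo)%E.
  rewrite integral_nneseries//.
  apply: (@le_lt_trans _ _ (\sum_(k <oo) (2^-1 ^+ k)%:E)%E).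
    apply: lee_nneseries => //; move=> k *; exact: integral_ge0.
  under eq_eseriesr do rewrite -[2^-1 ^+ _]mul1r.
  by apply: nneseries_geometric_lty; rewrite invr_ge0 invf_lt1 ?ltr1n// ler0n.
have sumi : mu.-integrable setT (fun x => \sum_(k <oo) h k x)%E.
  apply/integrableP; split; first exact: ge0_emeasurable_sum.
  by under eq_integral do rewrite gee0_abs ?nneseries_ge0//.
have := integrable_ae measurableT sumi.
apply: filterS => x /(_ I) sx.
have /cvg_ex[l fl] : cvgn (f ^~ x).
  apply: (@cvgn_weighted_steps _ _ (fine (\sum_(k <oo) h k x)%E)) => k.
  rewrite -lee_fin fineK//.
  apply: le_trans (nneseries_lim_ge k.+1 _) => //.
  by rewrite big_nat_recr//= leeDr// sume_ge0.
by rewrite (cvg_llim fl).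
Qed.

(** Fatou's lemma in [m], for fixed [n], applied to the squares of [f n - f m]. The limit [g] is
    arbitrary so that it can be [gd s] of a limit as well as the limit itself. *)
Lemma fatou_cauchy f g (e : nat -> R) : (forall n, sqint mu (f n)) ->
  measurable_fun setT g ->
  {ae mu, forall x, f n x @[n --> \oo] --> g x} ->
  (forall n m, (n <= m)%N -> ip mu (f n - f m) (f n - f m) <= e n) ->
  sqint mu g /\ forall n, ip mu (f n - g) (f n - g) <= e n.
Proof.
move=> sf mg fg fC.
have mf n : measurable_fun setT (f n) by have [] := sf n.
have key n : (\int[mu]_x (((f n - g) x) ^+ 2)%:E <= (e n)%:E)%E.
  pose h m x := (((f n - f m) x) ^+ 2)%:E.
  have mh m : measurable_fun setT (h m).
    by apply/measurable_EFinP; apply: measurable_funX; exact: measurable_funB.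
  have h0 m x : (0 <= h m x)%E by rewrite lee_fin sqr_ge0.
  have := fatou mu measurableT mh (fun m x _ => h0 m x).
  move=> /(le_trans _) H; apply: (le_trans (H _ _)); last first.
    rewrite limn_einf_lim; apply: lime_le; first exact: is_cvg_einfs.
    exists n => // m /= nm; apply: (@le_trans _ _ (\int[mu]_x h m x)%E).
      by apply: ereal_inf_lbound; exists m => //=.
    by rewrite -EFin_ip ?lee_fin; [exact: fC|exact: sqintB].
  apply: ae_ge0_le_integral => //.
  - by move=> x _; rewrite lee_fin sqr_ge0.
  - by apply/measurable_EFinP; apply: measurable_funX; exact: measurable_funB.
  - move=> x _; rewrite limn_einf_lim; apply: lime_ge; first exact: is_cvg_einfs.
    apply: nearW => m; apply: le_ereal_inf_tmp => _ [k _ <-]; exact: h0.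
  - rewrite (_ : (fun x => limn_einf (h ^~ x)) =
       fun x => (- limn_esup (fun m => - h m x))%E); last by [].
    apply: measurableT_comp => //; apply: measurable_fun_limn_esup => m.
    exact: measurableT_comp.
  - apply: filterS fg => x fgx _.
    have /cvg_limn_einf_sup[-> _] : h m x @[m --> \oo] --> (((f n - g) x) ^+ 2)%:E.
      apply: cvg_EFin; first exact: nearW.
      apply: (@cvgM _ _ _ _ (fun m => (f n - f m) x)); apply: cvgB => //; exact: cvg_cst.
    by [].
have sng n : sqint mu (f n - g).
  split; first exact: measurable_funB.
  exact: le_lt_trans (key n) (ltry _).
split=> [|n]; last by rewrite -lee_fin EFin_ip.
by rewrite (_ : g = f 0%N - (f 0%N - g)); [exact: sqintB|rewrite opprB addrC subrK].
Qed.

Lemma fast_cauchy_llim f : (forall n, sqint mu (f n)) ->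
  (forall n m, (n <= m)%N -> ip mu (f n - f m) (f n - f m) <= 8^-1 ^+ n) ->
  [/\ {ae mu, forall x, f n x @[n --> \oo] --> llim f x}, sqint mu (llim f) &
      forall n, ip mu (f n - llim f) (f n - llim f) <= 8^-1 ^+ n].
Proof.
move=> sf fC.
have ae : {ae mu, forall x, f n x @[n --> \oo] --> llim f x}.
  apply: cvg_llim_ae => // n; apply: le_trans (fC n n.+1 (leqnSn _)).
  rewrite -[f n.+1 - _]opprB -scaleN1r ipZl ?ipZr ?mulN1r ?opprK//.
  - exact: sqintB.
  - exact: sqintB.
  - exact: sqintB.
  - by apply: sqintZ; exact: sqintB.
have [|sg fg] := fatou_cauchy sf _ ae fC; last by [].
by apply: measurable_llim => n; have [] := sf n.
Qed.

End square_integrable_limits.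

(** * Null sets of d-dimensional Lebesgue measure *)

Section lebesgue_rV_geometry.
Variable R : realType.
Local Notation leb := (@lebesgue_rV R).

Lemma lebesgue_measure_shift (t : R) (A : set R) : measurable A ->
  pushforward lebesgue_measure ((fun x => x + t) : _ -> measurableTypeR R) A =
  lebesgue_measure A.
Proof.
move=> mA.
have mt : measurable_fun setT ((fun x => x + t) : measurableTypeR R -> measurableTypeR R).
  by apply: measurable_funD.
pose mt' : {mfun measurableTypeR R >-> measurableTypeR R} :=
  HB.pack ((fun x => x + t) : measurableTypeR R -> measurableTypeR R)
    (isMeasurableFun.Build _ _ _ _ _ mt).
apply/esym/(@lebesgue_measure_unique _ (pushforward lebesgue_measure mt')) => //=.
move=> _ [[a b]] _ <-.
rewrite /pushforward/= (_ : _ @^-1` _ = `](a - t), (b - t)]%classic); last first.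
  by apply/seteqP; split => x /=; rewrite !in_itv/= ltrBlDr lerBrDr.
rewrite !lebesgue_measure_itv/= !lte_fin ltrD2r -!EFinB.
by rewrite (_ : b - t - (a - t) = b - a)//; ring.
Qed.

Lemma ge0_integral_shift (t : R) (g : measurableTypeR R -> \bar R) :
  measurable_fun setT g -> (forall x, 0 <= g x)%E ->
  (\int[lebesgue_measure]_x g (x + t)%R = \int[lebesgue_measure]_x g x)%E.
Proof.
move=> mg g0.
have mt : measurable_fun setT ((fun x => x + t) : measurableTypeR R -> measurableTypeR R).
  by apply: measurable_funD.
rewrite -[LHS](@ge0_integral_pushforward _ _ _ _ _ _ mt _ setT)//.
by apply: eq_measure_integral => //= A mA _; exact: lebesgue_measure_shift.
Qed.

Lemma rV_consD n (p : measurableTypeR R * 'rV[R]_n) (t : 'rV[R]_n.+1) :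
  rV_cons p + t = rV_cons (p.1 + t ord0 ord0, p.2 + \row_j t ord0 (lift ord0 j)).
Proof.
apply/rowP => i; rewrite mxE; case: (unliftP ord0 i) => [j|] ->.
  by rewrite !rV_consS !mxE.
by rewrite !rV_cons0.
Qed.

Lemma measurable_rV_shift n (t : 'rV[R]_n) :
  measurable_fun setT (fun x : 'rV[R]_n => x + t).
Proof.
apply: measurable_fun_rVP => i; under eq_fun do rewrite mxE.
by apply: measurable_funD => //; exact: measurable_coor.
Qed.

Lemma measurable_rV_cons_preimage n (A : set 'rV[R]_n.+1) : measurable A ->
  measurable (@rV_cons R n @^-1` A).
Proof. by move=> mA; rewrite -[X in measurable X]setTI; exact: measurable_rV_cons. Qed.

(** Induction on the dimension: the sections along the first coordinate are shifted by the induction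
    hypothesis, the outer integral by invariance on the line. *)
Lemma lebesgue_rV_shift n (t : 'rV[R]_n) A : measurable A ->
  leb n ((fun x => x + t) @^-1` A) = leb n A.
Proof.
elim: n => [|n ih] in t A *.
  by move=> _; congr (leb 0 _); apply/seteqP; split => x /=;
     rewrite [t]thinmx0 addr0.
move=> mA; rewrite /= /lebesgue_rV_step /pushforward /product_measure1.
set B := @rV_cons R n @^-1` A; have mB : measurable B by exact: measurable_rV_cons_preimage.
rewrite -(@ge0_integral_shift (t ord0 ord0) (leb n \o xsection B))//; last first.
  exact: measurable_fun_xsection.
apply: eq_integral => x _ /=.
rewrite -[RHS](ih (\row_j t ord0 (lift ord0 j)))//; last exact: measurable_xsection.
congr (leb n _); apply/seteqP; split => y; rewrite !xsectionE /=;
  by rewrite rV_consD /=.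
Qed.

Lemma coord_bounded_set n (A : set 'rV[R]_n) : bounded_set A ->
  exists2 M : R, 0 < M & forall x, A x -> forall i, `|x ord0 i| < M.
Proof.
move=> /ex_strict_bound_gt0[M M0 AM]; exists M => // x Ax i.
apply: le_lt_trans (AM x Ax); rewrite /= [leRHS]mx_normrE.
by apply: (le_bigmax_cond _ (fun ij => `|x ij.1 ij.2|) (j := (ord0, i))).
Qed.

Lemma lebesgue_rV_bounded n (A : set 'rV[R]_n) (M : R) : measurable A ->
  (forall x, A x -> forall i, `|x ord0 i| < M) -> (leb n A < +oo)%E.
Proof.
move=> mA AM; pose I (_ : 'I_n) : interval R := `]-M, M[.
apply: (@le_lt_trans _ _ (leb n [set x | forall i, x ord0 i \in I i])).
  apply: le_measure; rewrite ?inE//; first exact: measurable_rV_box.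
  by move=> x Ax i; rewrite /I in_itv/= -ltr_norml; exact: AM.
rewrite lebesgue_rV_box.
set p := (\prod_(_ < _) _)%E; suff /andP[] : (0 <= p < +oo)%E by [].
apply: (big_ind (fun y : \bar R => 0 <= y < +oo)%E) => [|x y|i _].
- by rewrite lee01 ltry.
- move=> /andP[x0 xoo] /andP[y0 yoo]; rewrite mule_ge0//=.
  by apply: lte_mul_pinfty => //; rewrite ge0_fin_numE.
- by rewrite measure_ge0/= (lebesgue_measure_itv (I i))/=; case: ifP => // _; rewrite -EFinD ltry.
Qed.

(* A bounded set with infinitely many disjoint translates inside a bounded set
   is null. *)
Lemma null_translates n (B : set 'rV[R]_n) (e : 'rV[R]_n) (M : R) :
  measurable B -> (forall x, B x -> forall i, `|x ord0 i| < M) ->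
  (forall x t, B x -> B (x + t *: e) -> t = 0) -> leb n B = 0.
Proof.
move=> mB BM Be.
(* The offsets [1 / (j + 1)] are distinct, which the last hypothesis turns into disjointness, and at
   most [1], which keeps all translates in one bounded set. *)
pose F (j : nat) := (fun x : 'rV[R]_n => x + (- (j.+1%:R^-1) *: e)) @^-1` B.
have mF j : measurable (F j).
  by rewrite -[F j]setTI; exact: measurable_rV_shift.
have tF : trivIset setT F.
  apply/trivIsetP => i j _ _; apply: contra_neqP => /eqP/set0P[x [Fi Fj]].
  have : i.+1%:R^-1 - j.+1%:R^-1 = 0 :> R.
    apply: (Be _ _ Fi); rewrite -addrA -scalerDl addrA addNr add0r.
    exact: Fj.
  by move/eqP; rewrite subr_eq0 => /eqP /invr_inj /eqP; rewrite eqr_nat eqSS => /eqP.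
have Uoo : (leb n (\bigcup_j F j) < +oo)%E.
  pose M' := M + \sum_i `|e ord0 i|.
  apply: (@lebesgue_rV_bounded _ _ M'); first exact: bigcup_measurable.
  move=> x [j _ Fj] i; have := BM _ Fj i; rewrite !mxE => xM.
  rewrite -[x ord0 i](addrNK (j.+1%:R^-1 * e ord0 i)) /M'.
  apply: le_lt_trans (ler_normD _ _) _; rewrite -mulNr; apply: ltr_leD => //.
  rewrite normrM ger0_norm//; apply: (@le_trans _ _ `|e ord0 i|).
    by rewrite ler_piMl// invf_le1 ?ler1n.
  by rewrite (bigD1 i)//= lerDl sumr_ge0.
have cst j : leb n (F j) = leb n B by exact: lebesgue_rV_shift.
rewrite measure_bigcup// in Uoo.
have Bfin : leb n B \is a fin_num.
  by rewrite ge0_fin_numE//; exact: lebesgue_rV_bounded BM.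
apply/eqP; rewrite eq_le measure_ge0 andbT.
move: Uoo; rewrite (eq_eseriesr (fun i _ => cst i)).
rewrite -[leb n B]fineK// lee_fin; set r := fine _ => Uoo.
have [S S0 rS] : exists2 S : R, 0 <= S & forall k, r *+ k <= S.
  pose s := (\sum_(i <oo | i \in [set: nat]) r%:E)%E.
  have r0 : 0 <= r by rewrite fine_ge0.
  have s0 : (0 <= s)%E by apply: nneseries_ge0 => *; rewrite lee_fin.
  exists (fine s) => [|k]; first exact: fine_ge0.
  rewrite -lee_fin fineK ?ge0_fin_numE//.
  apply: le_trans (nneseries_lim_ge k _); last by move=> *; rewrite lee_fin.
  rewrite sumEFin lee_fin big_mkord (eq_bigl xpredT); last by move=> i; rewrite in_setT.
  by rewrite sumr_const card_ord.
rewrite leNgt; apply/negP => r0.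
have := rS (Num.truncn (S / r)).+1.
rewrite leNgt -[r *+ _]mulr_natl -ltr_pdivrMr//.
by rewrite truncnS_gt.
Qed.

Definition rat_box n (pq : 'rV[rat]_n * 'rV[rat]_n) : set 'rV[R]_n :=
  [set y | forall i, y ord0 i \in `]ratr (pq.1 ord0 i), ratr (pq.2 ord0 i)[ ].

Lemma rat_box_nbhs n (x : 'rV[R]_n) (A : set 'rV[R]_n) : nbhs x A ->
  exists pq, rat_box pq x /\ rat_box pq `<=` A.
Proof.
move=> /nbhs_ballP[e /= e0 xeA].
have /choice[p xp] i : exists p, ratr p \in `](x ord0 i - e), (x ord0 i)[.
  by apply: rat_in_itvoo; rewrite ltrBlDr ltrDl.
have /choice[q xq] i : exists q, ratr q \in `](x ord0 i), (x ord0 i + e)[.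
  by apply: rat_in_itvoo; rewrite ltrDl.
exists (\row_i p i, \row_i q i); split => [i|y yb].
  rewrite /= !mxE in_itv/=.
  by move: (xp i) (xq i); rewrite !in_itv/= => /andP[_ ->] /andP[->].
apply: xeA; split => // i0 i; rewrite (ord1 i0) /ball/= ltr_distlC.
move: (yb i) (xp i) (xq i); rewrite /= !mxE !in_itv/=.
move=> /andP[py yq] /andP[xp1 _] /andP[_ xq2].
by rewrite (lt_trans xp1 py) (lt_trans yq xq2).
Qed.

(* Lindelof: rational boxes form a countable base. *)
Lemma negligible_locally n (A : set 'rV[R]_n) :
  (forall x, A x -> exists2 U, nbhs x U & (leb n).-negligible (A `&` U)) ->
  (leb n).-negligible A.
Proof.
move=> Aloc.
pose F k : set 'rV[R]_n :=
  if unpickle k is Some pq then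
    if `[< (leb n).-negligible (A `&` rat_box pq) >] then A `&` rat_box pq else set0
  else set0.
apply: (@negligibleS _ _ _ _ (\bigcup_k F k)); last first.
  apply: negligible_bigcup => k; rewrite /F.
  case: (unpickle k) => [pq|]; last exact: negligible_set0.
  by case: ifPn => [/asboolP//|_]; exact: negligible_set0.
move=> x Ax; have [U xU AU] := Aloc x Ax.
have [pq [xpq pqU]] := rat_box_nbhs xU.
exists (pickle pq) => //; rewrite /F pickleK ifT//.
by apply/asboolP; apply: negligibleS AU => y [Ay yb]; split => //; exact: pqU.
Qed.

Lemma ler_coord_norm n (x : 'rV[R]_n) i : `|x ord0 i| <= `|x|.
Proof.
rewrite [leRHS]mx_normrE.
exact: (le_bigmax_cond _ (fun ij => `|x ij.1 ij.2|) (j := (ord0, i))).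
Qed.

Lemma rV_norm_le n (x : 'rV[R]_n) c : 0 <= c -> (forall i, `|x ord0 i| <= c) ->
  `|x| <= c.
Proof.
by move=> c0 xc; rewrite [leLHS]mx_normrE; apply: bigmax_le => // -[j i] _ /=;
  rewrite (ord1 j).
Qed.

Lemma lipschitz_graph_continuous n (Q : 'M[R]_n) (k : 'I_n)
    (gamma : 'rV[R]_n.-1 -> R) : lipschitz gamma ->
  continuous (fun x : 'rV[R]_n => (x *m Q) ord0 k - gamma (col' k (x *m Q))).
Proof.
move=> /pinfty_ex_gt0[K K0 gK].
have {}gK p q : `|gamma p - gamma q| <= K * `|p - q|.
  by have := gK (p, q) (conj I I).
pose C := \sum_i \sum_j `|Q i j|.
have C0 : 0 <= C by rewrite sumr_ge0// => i _; rewrite sumr_ge0.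
have normQ (x : 'rV[R]_n) : `|x *m Q| <= C * `|x|.
  apply: rV_norm_le => [|j]; first by rewrite mulr_ge0.
  rewrite mxE; apply: le_trans (ler_norm_sum _ _ _) _.
  rewrite /C mulr_suml; apply: ler_sum => i _.
  rewrite normrM mulrC ler_pM ?normr_ge0 ?ler_coord_norm//.
  by rewrite (bigD1 j)//= lerDl sumr_ge0.
set phi := (fun x => _).
(* The summand [1] keeps the Lipschitz constant positive, so that it can be divided by. *)
have lip x y : `|phi x - phi y| <= (1 + (C + K * C)) * `|x - y|.
  have -> : phi x - phi y = ((x - y) *m Q) ord0 k
      - (gamma (col' k (x *m Q)) - gamma (col' k (y *m Q))).
    by rewrite /phi mulmxBl !mxE; ring.
  rewrite mulrDl mul1r; apply: ler_wpDl => //; rewrite mulrDl.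
  apply: le_trans (ler_normB _ _) _; apply: lerD.
    exact: le_trans (ler_coord_norm _ _) (normQ _).
  apply: le_trans (gK _ _) _; rewrite -mulrA ler_wpM2l ?(ltW K0)//.
  apply: le_trans (normQ _); apply: rV_norm_le => // i.
  have -> : (col' k (x *m Q) - col' k (y *m Q)) ord0 i =
      ((x - y) *m Q) ord0 (lift k i) by rewrite mulmxBl !mxE.
  exact: ler_coord_norm.
move=> x; apply/(@cvgrPdist_lt _ _ _ (nbhs x) (nbhs_filter x)) => e e0.
have L0 : 0 < 1 + (C + K * C).
  by apply: ltr_pwDl => //; rewrite addr_ge0// mulr_ge0// ltW.
have : \forall y \near x, `|x - y| < e / (1 + (C + K * C)).
  apply/nbhs_ballP; exists (e / (1 + (C + K * C))); first by rewrite /= divr_gt0.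
  by move=> y; rewrite mx_norm_ball.
apply: filterS => y xy; apply: le_lt_trans (lip x y) _.
by rewrite mulrC -ltr_pdivlMr.
Qed.

Lemma closed_measurable_rV n (A : set 'rV[R]_n) : closed A -> measurable A.
Proof.
by move=> cA; rewrite -[A]setCK; apply: measurableC; apply: open_measurable_rV;
   exact: closed_openC.
Qed.

Lemma lipschitz_boundary_negligible n (Omega : set 'rV[R]_n) : open Omega ->
  lipschitz_boundary Omega -> (leb n).-negligible (boundary Omega).
Proof.
move=> oO lO; apply: negligible_locally => x0 bx0.
have [Q [k [gamma [QQ lg]]]] := lO x0 bx0.
move=> /nbhs_ballP[r /= r0 rP].
exists (ball x0 r); first exact: nbhsx_ballx.
set B := _ `&` _.
have mB : measurable B.
  apply: measurableI; last by apply: open_measurable_rV; exact: ball_open.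
  apply: measurableD.
    exact: closed_measurable_rV (@closed_closure _ _).
  by apply: open_measurable_rV; exact: open_interior.
apply/negligibleP => //.
pose phi x := (x *m Q) ord0 k - gamma (col' k (x *m Q)).
(* A boundary point is outside the open set [Omega], so [phi x >= 0]. If [phi x > 0], continuity
   would keep [phi] positive near [x], where points of [Omega] exist. *)
have graph x : B x -> phi x = 0.
  move=> [[cx ix] bx].
  have nOx : ~ Omega x by move=> Ox; apply: ix; rewrite (interior_id _).1.
  apply/eqP; rewrite eq_le; apply/andP; split; last first.
    by rewrite subr_ge0 leNgt; apply/negP => /(rP x bx).2.
  rewrite leNgt; apply/negP => phix.
  have phi_near : \forall y \near x, 0 < phi y.
    by apply: (cvgr_gt _ (lipschitz_graph_continuous (Q := Q) (k := k) lg (x := x))).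
  have ball_near : \forall y \near x, ball x0 r y.
    by apply: open_nbhs_nbhs; split => //; exact: ball_open.
  have [y [Oy [py b_y]]] := cx _ (filterI phi_near ball_near).
  by have := (rP y b_y).1 Oy; rewrite -subr_lt0 => /(lt_trans py); rewrite ltxx.
(* The [k]-th axis of the rotated coordinates: moving along it changes the height and not the base
   point, so it leaves the graph at once. *)
pose e : 'rV[R]_n := delta_mx ord0 k *m Q^T.
have eQ x t : (x + t *: e) *m Q = x *m Q + t *: delta_mx ord0 k.
  by rewrite mulmxDl -scalemxAl -mulmxA (mulmx1C QQ) mulmx1.
apply: (@null_translates _ _ e (`|x0| + r)) => //.
  move=> x [_ [_ bx]] i; have := bx ord0 i; rewrite /ball/= => xi.
  rewrite -[x ord0 i](subrK (x0 ord0 i)) addrC.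
  apply: le_lt_trans (ler_normD _ _) _; apply: ler_ltD; first exact: ler_coord_norm.
  by rewrite distrC.
move=> x t /graph + /graph; rewrite /phi eQ.
have -> : col' k (x *m Q + t *: delta_mx ord0 k) = col' k (x *m Q).
  apply/rowP => i; rewrite !mxE [lift k i == k]eq_sym (negbTE (neq_lift _ _)).
  by rewrite andbF mulr0 addr0.
have -> : (x *m Q + t *: delta_mx ord0 k) ord0 k = (x *m Q) ord0 k + t.
  by rewrite [LHS]mxE [X in _ + X]mxE [X in t * X]mxE !eqxx mulr1.
lra.
Qed.

End lebesgue_rV_geometry.

(** * The normalising constant of the fractional Laplacian *)

Section gamma_function.
Variable R : realType.
Local Notation leb := (@lebesgue_measure R).

(** The integrand is below the sum of the functions [c k * \1_(F k)], whatever the overlaps of the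
    [F k]. This proves convergence of the integral of [Gamma] without antiderivatives. *)
Lemma integral_lty_cover d (T : measurableType d) (mu : {measure set T -> \bar R})
    (D : set T) (f : T -> R) (F : (set T)^nat) (c : nat -> R) :
  measurable D -> measurable_fun D f -> (forall t, D t -> 0 <= f t) ->
  (forall k, measurable (F k)) -> (forall k, 0 <= c k) ->
  (forall t, D t -> exists2 k, F k t & f t <= c k) ->
  (\sum_(k <oo) (c k)%:E * mu (F k) < +oo)%E ->
  (\int[mu]_(t in D) (f t)%:E < +oo)%E.
Proof.
move=> mD mf f0 mF c0 fc coo; apply: le_lt_trans coo.
have mI k : measurable_fun setT (fun t => (c k * \1_(F k) t)%:E).
  by apply/measurable_EFinP; apply: measurable_funM.
have I0 k t : (0 <= (c k * \1_(F k) t)%:E)%E by rewrite lee_fin mulr_ge0.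
apply: (@le_trans _ _ (\int[mu]_(t in D) \sum_(k <oo) (c k * \1_(F k) t)%:E)%E).
  apply: ge0_le_integral => //.
  - exact/measurable_EFinP.
  - by apply: ge0_emeasurable_sum => // k _; apply: measurable_funTS.
  move=> t Dt; have [k Fk fk] := fc t Dt.
  apply: (@le_trans _ _ (c k * \1_(F k) t)%:E).
    by rewrite indicE mem_set// mulr1 lee_fin.
  apply: le_trans (nneseries_lim_ge k.+1 _) => //.
  by rewrite big_nat_recr//= leeDr// sume_ge0.
apply: (@le_trans _ _ (\int[mu]_t \sum_(k <oo) (c k * \1_(F k) t)%:E)%E).
  apply: ge0_subset_integral => //.
  - exact: ge0_emeasurable_sum.
  - by move=> t _; exact: nneseries_ge0.
rewrite integral_nneseries//; apply: lee_nneseries => [*|k _].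
  exact: integral_ge0.
under eq_integral do rewrite EFinM.
rewrite ge0_integralZl//; first by rewrite integral_indic// setIT.
- by apply/measurable_EFinP.
- by rewrite lee_fin.
Qed.

Variable x : R.
Hypothesis x0 : 0 < x.
Let f (t : R) := t `^ (x - 1) * expR (- t).

Let f_ge0 t : 0 <= f t.
Proof. by rewrite mulr_ge0 ?powR_ge0 ?expR_ge0. Qed.

Let mf D : measurable D -> measurable_fun D f.
Proof.
move=> mD; apply: measurable_funTS; apply: measurable_funM.
  exact: measurable_powR.
by apply: measurableT_comp => //; exact: measurable_expR.
Qed.

(** For [y = - ln t] and [k <= y < k + 1], [t^(x - 1) = exp (y - x y) <= exp (k + 1 - x k)].
    Multiplied by the length [exp (- k)], this leaves a geometric series of ratio [exp (- x)]. *)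
Let f01 : (\int[leb]_(t in `]0%R, 1%R]) (f t)%:E < +oo)%E.
Proof.
apply: (@integral_lty_cover _ (measurableTypeR R) leb _ f (fun k => `]0, (expR (- k%:R))]%classic)
  (fun k => expR (k%:R + 1 - x * k%:R))) => //.
- exact: mf.
- move=> t; rewrite /= in_itv/= => /andP[t0 t1].
  pose y := - ln t; have y0 : 0 <= y by rewrite oppr_ge0 ln_le0.
  have := truncn_itv y0; set k := Num.truncn y => /andP[ky yk].
  have te : t = expR (- y) by rewrite opprK lnK.
  exists k; first by rewrite /= in_itv/= t0/= te ler_expR lerN2.
  apply: (@le_trans _ _ (t `^ (x - 1))).
    by rewrite ler_piMr ?powR_ge0// expR_le1 oppr_le0 ltW.
  rewrite /powR gt_eqF// ler_expR -[ln t]opprK -/y.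
  move: yk; rewrite -natr1 => yk.
  have : x * k%:R <= x * y by rewrite ler_wpM2l// ltW.
  lra.
- rewrite (eq_eseriesr (g := fun k => (expR 1 * (expR (- x)) ^+ k)%:E)).
    by apply: nneseries_geometric_lty; rewrite expR_ge0 expR_lt1 oppr_lt0.
  move=> k _.
  have lk : lebesgue_measure `]0, (expR (- k%:R) : R)]%classic = (expR (- k%:R))%:E.
    by rewrite lebesgue_measure_itv/= lte_fin expR_gt0 -EFinB subr0.
  apply: (etrans (congr1 (fun y => (expR (k%:R + 1 - x * k%:R))%:E * y)%E lk)).
  rewrite -EFinM.
  by congr (_%:E); rewrite -expRD -expRM_natl -expRD mulrN mulrC; congr expR; ring.
Qed.

Let f1y : (\int[leb]_(t in `]1%R, +oo[) (f t)%:E < +oo)%E.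
Proof.
(* From [ln z <= z - 1] at [z = t / (2 x)] comes [x ln t <= x (ln (2 x) - 1) + t / 2], hence
   [f t <= C exp (- t / 2)] for [t > 1]. *)
pose C := expR (x * (ln (2 * x) - 1)).
have x2 : 0 < 2 * x by rewrite mulr_gt0.
apply: (@integral_lty_cover _ (measurableTypeR R) leb _ f (fun k => `[k%:R, k.+1%:R]%classic)
  (fun k => C * expR (- 2^-1) ^+ k)) => //.
- exact: mf.
- by move=> k; rewrite mulr_ge0 ?expR_ge0// exprn_ge0 ?expR_ge0.
- move=> t; rewrite /= in_itv/= andbT => t1.
  have t0 : 0 < t by exact: lt_trans t1.
  have := truncn_itv (ltW t0); set k := Num.truncn t => /andP[kt tk].
  exists k; first by rewrite /= in_itv/= kt ltW.
  rewrite /f /powR gt_eqF// /C -expRM_natl -!expRD ler_expR.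
  have lt0 : 0 <= ln t by rewrite ln_ge0// ltW.
  have : ln (t / (2 * x)) <= t / (2 * x) - 1.
    have := @le_ln1Dx R (t / (2 * x) - 1); rewrite addrCA subrr addr0; apply.
    by rewrite ltrBrDr addrC subrr divr_gt0.
  rewrite ln_div ?posrE// => h.
  have : x * (ln t - ln (2 * x)) <= t / 2 - x.
    rewrite (_ : t / 2 - x = x * (t / (2 * x) - 1)); last by field; rewrite gt_eqF.
    by rewrite ler_wpM2l// ltW.
  rewrite !mulrBr mulrN mulr1; set X := x * ln t; set Y := x * _ => h2.
  rewrite mulrBl mul1r -/X; lra.
- rewrite (eq_eseriesr (g := fun k => (C * expR (- 2^-1) ^+ k)%:E)).
    by apply: nneseries_geometric_lty; rewrite expR_ge0 expR_lt1 oppr_lt0 invr_gt0/=.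
  move=> k _.
  have lk : lebesgue_measure `[k%:R, k.+1%:R : R]%classic = 1%E.
    by rewrite lebesgue_measure_itv/= lte_fin ltr_nat leqnn -EFinB -natrB// subSnn.
  apply: (etrans (congr1 (fun y => (C * expR (- 2^-1) ^+ k)%:E * y)%E lk)).
  by rewrite mule1.
Qed.

(** [Gamma] is the [fine] part of an extended integral, which would be [0] if the integral diverged;
    positivity therefore requires convergence at [0] and at infinity. *)
Lemma Gamma_gt0 : 0 < Gamma x.
Proof.
rewrite /Gamma /Rintegral.
have D : [set` `]0, +oo[] = `]0, 1] `|` `]1, +oo[ :> set R.
  rewrite -itv_bndbnd_setU ?bnd_simp//.
apply: fine_gt0; apply/andP; split.
  rewrite lt_neqAle integral_ge0; last by move=> t _; rewrite lee_fin f_ge0.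
  rewrite andbT eq_sym; apply/eqP => I0.
  have : (\int[leb]_(t in `]0%R, +oo[) `|(f t)%:E| = 0)%E.
    by under eq_integral do rewrite gee0_abs ?lee_fin ?f_ge0//.
  move/ae_eq_integral_abs => /(_ _)[]//.
    by apply/measurable_EFinP; exact: mf.
  move=> N [mN N0 subN].
  have : (leb `]0%R, +oo[ <= leb N)%E.
    apply: le_measure; rewrite ?inE// => t t0; apply: subN => /= /(_ t0) [] ft0.
    move: t0; rewrite /= in_itv/= andbT => t0.
    have : 0 < f t by rewrite mulr_gt0 ?powR_gt0 ?expR_gt0.
    by rewrite ft0 ltxx.
  by rewrite N0 lebesgue_measure_itv/= ltry/= oppr0 addye// leye_eq.
rewrite D ge0_integral_setU//=.
- by apply: lte_add_pinfty; [exact: f01|exact: f1y].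
- by apply/measurable_EFinP; apply: mf; exact: measurableU.
- by move=> t _; rewrite lee_fin f_ge0.
- apply/disj_setPS => t [/=]; rewrite !in_itv/= => /andP[_ t1] /andP[].
  by rewrite ltNge t1.
Qed.

End gamma_function.

Lemma frac_lap_cst_gt0 (R : realType) d (s : R) : 0 < s < 1 -> 0 < frac_lap_cst d s.
Proof.
move=> /andP[s0 s1]; rewrite /frac_lap_cst divr_gt0// mulr_gt0 ?powR_gt0 ?pi_gt0//.
- by rewrite mulr_gt0// powR_gt0.
- by apply: Gamma_gt0; rewrite ltr_pwDl// divr_ge0.
- by apply: Gamma_gt0; rewrite subr_gt0.
Qed.

(** * The fractional Sobolev space *)

Section square_integrable_Lfun.
Context {dT : measure_display} {T : measurableType dT} {R : realType}.
Variable mu : {measure set T -> \bar R}.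

Lemma sqint_LfunP (f : T -> R) : f \in Lfun mu 2%:E <-> sqint mu f.
Proof.
split => [lf|[mf foo]].
  split; last exact: integrable_lty (Lfun2_integrable_sqr lf).
  by move: lf; rewrite inE => /andP[/[!inE]/= mf _].
rewrite inE; apply/andP; split; rewrite inE//= /finite_norm unlock.
apply: poweR_lty; apply: le_lt_trans foo.
by under eq_integral do rewrite /= powR_mulrn// real_normK ?num_real//.
Qed.

Lemma Lnorm2_sqr (f : T -> R) : sqint mu f ->
  fine ('N[mu]_2%:E [EFin \o f]) ^+ 2 = ip mu f f.
Proof.
move=> sf; rewrite unlock.
under eq_integral do rewrite /= powR_mulrn// real_normK ?num_real//.
rewrite -EFin_ip// poweR_EFin /= -powR_mulrn ?powR_ge0// -powRrM mulVf//.
by rewrite powRr1// ip_ge0.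
Qed.

Lemma ip_ae (f f' g : T -> R) : sqint mu f -> sqint mu f' -> sqint mu g ->
  {ae mu, forall x, f x = f' x} -> ip mu f g = ip mu f' g.
Proof.
move=> sf sf' sg ff'; congr fine; apply: ae_eq_integral => //.
- by have /integrableP[] := sqint_mul sf sg.
- by have /integrableP[] := sqint_mul sf' sg.
- by apply: filterS ff' => x -> _.
Qed.

Lemma sqint_ae (f g : T -> R) : measurable_fun setT g ->
  {ae mu, forall x, f x = g x} -> sqint mu f -> sqint mu g.
Proof.
move=> mg fg [mf foo]; split=> //; apply: le_lt_trans foo.
apply: ae_ge0_le_integral => //.
- by move=> x _; rewrite lee_fin sqr_ge0.
- by apply/measurable_EFinP; exact: measurable_funX.
- by move=> x _; rewrite lee_fin sqr_ge0.
- by apply/measurable_EFinP; exact: measurable_funX.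
- by apply: filterS fg => x -> _.
Qed.

Lemma ip_eq0_ae (f : T -> R) : sqint mu f -> ip mu f f = 0 ->
  {ae mu, forall x, f x = 0}.
Proof.
move=> sf f0; have mf2 : measurable_fun setT (fun x => (f x ^+ 2)%:E).
  by apply/measurable_EFinP; apply: measurable_funX; case: sf.
have : (\int[mu]_x `|(f x ^+ 2)%:E| = 0)%E.
  under eq_integral do rewrite gee0_abs ?lee_fin ?sqr_ge0//.
  by rewrite -EFin_ip// f0.
move/(ae_eq_integral_abs mu measurableT mf2); apply: filterS => x /(_ I)[].
by move/eqP; rewrite sqrf_eq0 => /eqP.
Qed.

End square_integrable_Lfun.

Section fractional_space.
Variables (R : realType) (d : nat).
Local Notation Rd := 'rV[R]_d.
Local Notation leb := (@lebesgue_rV R d).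
Local Notation leb2 := (@lebesgue_rV R d \x @lebesgue_rV R d)%E.
Implicit Types (Omega : set Rd) (u v w : Rd -> R) (s : R).

(* The exponent is negative rather than the quotient inverted, so that the value
   on the diagonal is [0], as it is in [gagliardo]. *)
Definition gk s (z : Rd * Rd) : R :=
  eucl_norm (z.1 - z.2) `^ (- ((d%:R + 2 * s) / 2)).

(** A linear map that turns the fractional Laplacian form into a multiple of an L^2 product on R^d x
    R^d. *)
Definition gd s v (z : Rd * Rd) : R := (v z.1 - v z.2) * gk s z.

Lemma measurable_gk s : measurable_fun setT (gk s).
Proof.
apply: (measurableT_comp (measurable_powR _)).
apply: (measurableT_comp (continuous_measurable_fun (@sqrt_continuous R))).
apply: measurable_sum => i; apply: measurable_funX.
under eq_fun do rewrite !mxE.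
by apply: measurable_funB; apply: (measurableT_comp (measurable_coor i)).
Qed.

Lemma gk_sqr s z : gk s z ^+ 2 = (eucl_norm (z.1 - z.2) `^ (d%:R + 2 * s))^-1.
Proof.
by rewrite -powR_mulrn ?powR_ge0// -powRrM mulNr divfK// powRN.
Qed.

Lemma measurable_gd s v : measurable_fun setT v -> measurable_fun setT (gd s v).
Proof.
move=> mv; apply: measurable_funM; last exact: measurable_gk.
by apply: measurable_funB; apply: (measurableT_comp mv).
Qed.

Lemma gdD s v w : gd s (v + w) = gd s v + gd s w.
Proof.
apply/funext => z.
have H (p q r t k : R) : (p + r - (q + t)) * k = (p - q) * k + (r - t) * k by ring.
exact: H.
Qed.

Lemma gdZ s a v : gd s (a *: v) = a *: gd s v.
Proof.
have H (p q k : R) : (a * p - a * q) * k = a * ((p - q) * k) by ring.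
by apply/funext => z; exact: H.
Qed.

Lemma gdB s v w : gd s (v - w) = gd s v - gd s w.
Proof. by rewrite gdD -scaleN1r gdZ scaleN1r. Qed.

Lemma gagliardoE s v : gagliardo s v = (\int[leb2]_z (gd s v z ^+ 2)%:E)%E.
Proof. by apply: eq_integral => z _; rewrite exprMn gk_sqr. Qed.

Lemma frac_lap_formE s v w :
  frac_lap_form s v w = frac_lap_cst d s / 2 * ip leb2 (gd s v) (gd s w).
Proof.
congr (_ * _); congr fine; apply: eq_integral => z _.
by rewrite -gk_sqr /gd; congr (_%:E); ring.
Qed.

Lemma ae_prod (P : Rd -> Prop) : {ae leb, forall x, P x} ->
  {ae leb2, forall z, P z.1 /\ P z.2}.
Proof.
move=> [N [mN N0 PN]]; apply: (@negligibleS _ _ _ _ (N `*` setT `|` setT `*` N)).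
  move=> z /= nP; apply: contrapT => zN; apply: nP.
  split; apply: contrapT => nP; apply: zN.
    by left; split => //; exact: PN.
  by right; split => //; exact: PN.
apply: negligibleU; apply/negligibleP.
- exact: measurableX.
- apply: (etrans (product_measure1E _ _ mN measurableT)).
  exact: etrans (congr1 (fun y => y * leb setT)%E N0) (mul0e _).
- exact: measurableX.
- apply: (etrans (product_measure1E _ _ measurableT mN)).
  exact: etrans (congr1 (fun y => leb setT * y)%E N0) (mule0 _).
Qed.

(* Equal to [Hs_tilde] as soon as the boundary of [Omega] is null. *)
Definition frac_space Omega s : set (Rd -> R) :=
  [set v | [/\ sqint leb v, sqint leb2 (gd s v) & forall x, ~ Omega x -> v x = 0]].

Lemma frac_spaceD Omega s v w : frac_space Omega s v -> frac_space Omega s w -> frac_space Omega s (v + w).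
Proof.
move=> [sv gv v0] [sw gw w0]; split; first exact: sqintD.
  by rewrite gdD; exact: sqintD.
by move=> x nx; exact: etrans (congr2 +%R (v0 x nx) (w0 x nx)) (addr0 0).
Qed.

Lemma frac_spaceZ Omega s a v : frac_space Omega s v -> frac_space Omega s (a *: v).
Proof.
move=> [sv gv v0]; split; first exact: sqintZ.
  by rewrite gdZ; exact: sqintZ.
by move=> x nx; exact: etrans (congr1 ( *%R a) (v0 x nx)) (mulr0 a).
Qed.

Lemma frac_spaceB Omega s v w : frac_space Omega s v -> frac_space Omega s w -> frac_space Omega s (v - w).
Proof. by move=> Vv Vw; apply: frac_spaceD => //; rewrite -scaleN1r; exact: frac_spaceZ. Qed.

Lemma frac_space0 Omega s : frac_space Omega s 0.
Proof.
have z dT (T : measurableType dT) (mu : {measure set T -> \bar R}) : sqint mu (0 : T -> R).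
  by split; [exact: measurable_cst|under eq_integral do rewrite expr0n; rewrite integral0].
split=> //; have -> : gd s 0 = 0 by apply/funext => x; rewrite /gd subrr mul0r.
exact: z.
Qed.

(** One pointwise limit serves both norms: by [ae_prod], the functions [gd s (f n)] converge almost
    everywhere to [gd s (llim f)], and Fatou's lemma does the rest. *)
Lemma frac_space_complete Omega s (f : nat -> Rd -> R) : (forall n, frac_space Omega s (f n)) ->
  (forall n m, (n <= m)%N -> ip leb (f n - f m) (f n - f m) <= 8^-1 ^+ n) ->
  (forall n m, (n <= m)%N ->
     ip leb2 (gd s (f n - f m)) (gd s (f n - f m)) <= 8^-1 ^+ n) ->
  [/\ frac_space Omega s (llim f),
      forall n, ip leb (f n - llim f) (f n - llim f) <= 8^-1 ^+ n &
      forall n, ip leb2 (gd s (f n - llim f)) (gd s (f n - llim f)) <= 8^-1 ^+ n].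
Proof.
move=> Vf fC gC.
have sf n : sqint leb (f n) by case: (Vf n).
have sg n : sqint leb2 (gd s (f n)) by case: (Vf n).
have [aef sl fl] := fast_cauchy_llim sf fC.
have [| |n m|sgl gl] := @fatou_cauchy _ _ _ leb2 (fun n => gd s (f n))
    (gd s (llim f)) (fun n => 8^-1 ^+ n) sg.
- by apply: measurable_gd; case: sl.
- apply: filterS (ae_prod aef) => z [z1 z2].
  by apply: cvgM; [exact: cvgB|exact: cvg_cst].
- by rewrite -gdB; exact: gC.
split=> [| |n]; [split=> //| by []| by rewrite gdB].
move=> x nx; apply: cvg_llim.
rewrite (_ : (fun n => f n x) = cst 0); first exact: cvg_cst.
by apply/funext => n; have [_ _ ->] := Vf n.
Qed.

(** The complement of the support is a possibly uncountable union of open sets on which [v] vanishes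
    almost everywhere; local negligibility makes it countable. *)
Lemma ae_support_vanish v (A : set Rd) : ae_support v `<=` A ->
  {ae leb, forall x, ~ A x -> v x = 0}.
Proof.
move=> sA; apply: negligible_locally => x /= nx.
have nAx : ~ A x by move=> Ax; apply: nx.
have [U [oU aeU] Ux] : (\bigcup_(U in [set U | open U /\
    {ae leb, forall x, U x -> v x = 0}]) U) x.
  by apply: contrapT => nU; apply: nAx; apply: sA.
exists U; first exact: open_nbhs_nbhs.
apply: negligibleS aeU => y [/= ny Uy] h; apply: ny => _; exact: h.
Qed.

(** Cutting off at [Omega] a function supported in the closure alters it only on the boundary, up to
    a null set. With a null boundary, neither the norm nor the seminorm changes. *)
Lemma Hs_tildeE Omega s : open Omega -> leb.-negligible (boundary Omega) ->
  Hs_tilde Omega s = frac_space Omega s.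
Proof.
move=> oO bO; have mO := open_measurable_rV oO.
apply/seteqP; split => [_ [v [[/sqint_LfunP sv gv] supv] <-]|v [sv gv v0]].
  have [mv _] := sv.
  have mvO : measurable_fun setT (v \_ Omega).
    have mvO : measurable_fun Omega v by exact: measurable_funTS.
    have := (measurable_restrictT v mO).
    by case=> h _; exact: h.
  have aev : {ae leb, forall x, v x = (v \_ Omega) x}.
    have bO' : {ae leb, forall x, ~ boundary Omega x}.
      by apply: negligibleS bO => x /= nb; apply: contrapT => ?; exact: nb.
    apply: filterS2 (ae_support_vanish supv) bO' => x vx nbx.
    rewrite patchE; case: ifPn => // xO.
    apply: vx => cx; apply: nbx; split=> //.
    by rewrite (interior_id _).1// => Ox; move: xO; rewrite mem_set.
  split.
  - exact: sqint_ae aev sv.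
  - apply: (@sqint_ae _ _ _ _ (gd s v)).
    + exact: measurable_gd.
    + by apply: filterS (ae_prod aev) => z [z1 z2]; rewrite /gd -z1 -z2.
    + by split; [exact: measurable_gd|rewrite -gagliardoE].
  - by move=> x nx; rewrite patchE memNset.
exists v; last first.
  by apply/funext => x; rewrite patchE; case: ifPn => // /negP xO;
     rewrite v0// => Ox; apply: xO; rewrite inE.
split; first by split; [exact/sqint_LfunP|rewrite gagliardoE; case: gv].
move=> x; apply: contra_notP => nx; exists (~` closure Omega) => //.
split; first exact: closed_openC (@closed_closure _ _).
by apply: nearW => y ny; apply: v0 => Oy; apply: ny; exact: subset_closure.
Qed.

End fractional_space.

(** * Compact embedding into L^2 *)

Section lagrange_identity.
Context {dT : measure_display} {T : measurableType dT} {R : realType}.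

Lemma sqint_indic (mu : {measure set T -> \bar R}) (A : set T) : measurable A ->
  (mu A < +oo)%E -> sqint mu (\1_A).
Proof.
move=> mA Aoo; split=> //.
rewrite (_ : (fun x => _) = (fun x => (\1_A x)%:E)).
  by rewrite integral_indic// setIT.
by apply/funext => x; rewrite indicE; case: (x \in A); rewrite ?expr1n ?expr0n.
Qed.

Lemma ip_indic (mu : {measure set T -> \bar R}) (A : set T) : measurable A ->
  (mu A < +oo)%E -> (ip mu (\1_A) (\1_A))%:E = mu A.
Proof.
move=> mA Aoo; rewrite EFin_ip; last exact: sqint_indic.
rewrite (_ : (fun x => _) = (fun x => (\1_A x)%:E)).
  by rewrite integral_indic// setIT.
by apply/funext => x; rewrite indicE; case: (x \in A); rewrite ?expr1n ?expr0n.
Qed.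

Lemma sum_ip (mu : {measure set T -> \bar R}) (I : finType) (F : I -> T -> R) :
  (forall j, sqint mu (F j)) ->
  (\sum_j ip mu (F j) (F j))%:E = (\int[mu]_x (\sum_j F j x ^+ 2)%:E)%E.
Proof.
move=> sF; rewrite -sumEFin; under [RHS]eq_integral do rewrite -sumEFin.
rewrite ge0_integral_sum//.
- by apply: eq_bigr => j _; rewrite EFin_ip.
- by move=> j; apply/measurable_EFinP; apply: measurable_funX; case: (sF j).
- by move=> j x _; rewrite lee_fin sqr_ge0.
Qed.

(* For [e] the indicator of a cube [A] and [f = w * e], this expresses the L^2
   norm of [w] on [A] by its mean and its increments on [A * A]. *)
Lemma lagrange_identity (mu : {sigma_finite_measure set T -> \bar R}) (f e : T -> R) :
  sqint mu f -> sqint mu e ->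
  (\int[(mu \x mu)%E]_z ((f z.1 * e z.2 - e z.1 * f z.2) ^+ 2)%:E)%E =
  (2 * (ip mu e e * ip mu f f - ip mu f e ^+ 2))%:E.
Proof.
move=> sf se; have [mf _] := sf; have [me _] := se.
rewrite fubini_tonelli1/=; last 2 first.
- apply/measurable_EFinP; apply: measurable_funX; apply: measurable_funB;
   by apply: measurable_funM; [exact: measurableT_comp|exact: measurableT_comp].
- by move=> z; rewrite lee_fin sqr_ge0.
rewrite /fubini_F /=.
have inner x : (\int[mu]_y ((f x * e y - e x * f y) ^+ 2)%:E)%E =
  (f x * f x * ip mu e e - 2 * ip mu f e * (f x * e x) + e x * e x * ip mu f f)%:E.
  have s1 := sqintZ (f x) se; have s2 := sqintZ (e x) sf.
  rewrite -[LHS](@EFin_ip _ _ _ mu (f x *: e - e x *: f)); last exact: sqintB.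
  congr (_%:E); rewrite ipBl ?ipBr ?ipZl ?ipZr//; last exact: sqintB.
  by rewrite (ipC mu e f); ring.
under eq_integral do rewrite inner.
have iff := sqint_mul sf sf; have iee := sqint_mul se se; have ife := sqint_mul sf se.
have i1 : mu.-integrable setT (fun x => (f x * f x * ip mu e e)%:E).
  by under eq_fun do rewrite EFinM; exact: integrableZr.
have i2 : mu.-integrable setT (fun x => (2 * ip mu f e * (f x * e x))%:E).
  by under eq_fun do rewrite EFinM; exact: integrableZl.
have i3 : mu.-integrable setT (fun x => (e x * e x * ip mu f f)%:E).
  by under eq_fun do rewrite EFinM; exact: integrableZr.
have i12 : mu.-integrable setT
    (fun x => (f x * f x * ip mu e e - 2 * ip mu f e * (f x * e x))%:E).
  by under eq_fun do rewrite EFinB; exact: integrableB.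
rewrite -[LHS]fineK; last first.
  apply: integrable_fin_num => //; under eq_fun do rewrite EFinD.
  exact: integrableD.
congr (_%:E); rewrite -[LHS]/(Rintegral _ _ _) RintegralD// RintegralB//.
by rewrite RintegralZr// RintegralZl// RintegralZr// /ip; ring.
Qed.

End lagrange_identity.

Section disjoint_families.
Variables (R : realType) (T : Type) (I : finType) (Q : I -> set T).
Hypothesis Q_disj : forall x j j', Q j x -> Q j' x -> j = j'.

Lemma sum_indic_eq (j : I) (x : T) (F : I -> R) : Q j x ->
  \sum_i \1_(Q i) x * F i = F j.
Proof.
move=> Qx; rewrite (bigD1 j)//= big1 ?addr0 => [|i /eqP ij].
  by rewrite indicE mem_set// mul1r.
by rewrite indicE memNset ?mul0r// => Qi; apply: ij; exact: Q_disj Qi Qx.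
Qed.

Lemma sum_indic_eq0 (x : T) (F : I -> R) : (forall j, ~ Q j x) ->
  \sum_i \1_(Q i) x * F i = 0.
Proof. by move=> nQ; rewrite big1// => i _; rewrite indicE memNset ?mul0r. Qed.

End disjoint_families.

Section rellich.
Variables (R : realType) (d : nat).
Local Notation Rd := 'rV[R]_d.
Local Notation leb := (@lebesgue_rV R d).
Local Notation leb2 := (@lebesgue_rV R d \x @lebesgue_rV R d)%E.

(** [lagrange_identity] for [w * \1_(Q j)], summed over the cells. On [Q j * Q j] the squared
    increment is at most [K] times the square of [gd s w], and the factor 2 of the identity turns
    [K] into [K / 2]. *)
Lemma partition_estimate (I : finType) (Q : I -> set Rd) (vol K s : R)
    (Omega : set Rd) (w : Rd -> R) :
  (forall x j j', Q j x -> Q j' x -> j = j') ->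
  (forall x, Omega x -> exists j, Q j x) ->
  (forall j, measurable (Q j)) -> (forall j, leb (Q j) = vol%:E) ->
  (forall j x y, Q j x -> Q j y -> eucl_norm (x - y) `^ (d%:R + 2 * s) <= K) ->
  0 <= K -> d%:R + 2 * s != 0 -> frac_space Omega s w ->
  vol * ip leb w w <= \sum_j ip leb w (\1_(Q j)) ^+ 2
    + K / 2 * ip leb2 (gd s w) (gd s w).
Proof.
move=> Qd QO mQ volQ KQ K0 p0 [sw gw w0].
have Qoo j : (leb (Q j) < +oo)%E by rewrite volQ ltry.
have sI j := sqint_indic (mQ j) (Qoo j).
pose f j : Rd -> R := w \* \1_(Q j).
have fle j x : `|f j x| <= `|w x|.
  rewrite /f normrM indicE; case: (x \in Q j); rewrite ?normr1 ?mulr1//.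
  by rewrite normr0 mulr0.
have sf j : sqint leb (f j).
  have [mw _] := sw; apply: (sqint_le _ (fle j) sw).
  by apply: measurable_funM => //; have [] := sI j.
have fI j : ip leb (f j) (\1_(Q j)) = ip leb w (\1_(Q j)).
  congr fine; apply: eq_integral => x _; rewrite /f /= indicE.
  by case: (x \in Q j); rewrite ?mulr1// !mulr0.
have volE j : ip leb (\1_(Q j)) (\1_(Q j)) = vol.
  by apply: EFin_inj; exact: etrans (ip_indic (mQ j) (Qoo j)) (volQ j).
have wf : ip leb w w = \sum_j ip leb (f j) (f j).
  apply: EFin_inj; rewrite sum_ip// EFin_ip//; apply: eq_integral => x _; congr (_%:E).
  rewrite (eq_bigr (fun j => \1_(Q j) x * w x ^+ 2)); last first.
    move=> j _; rewrite /f /= indicE; case: (x \in Q j); rewrite ?mulr1 ?mul1r//.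
    by rewrite mulr0 mul0r expr0n.
  have [[j Qj]|nQ] := pselect (exists j, Q j x).
    by rewrite (sum_indic_eq Qd _ Qj).
  rewrite sum_indic_eq0; last by move=> j Qj; apply: nQ; exists j.
  by rewrite w0 ?expr0n// => /QO.
pose g j (z : Rd * Rd) := f j z.1 * \1_(Q j) z.2 - \1_(Q j) z.1 * f j z.2.
have gE j z : g j z = \1_(Q j) z.1 * \1_(Q j) z.2 * (w z.1 - w z.2).
  by rewrite /g /f /=; ring.
have mg j : measurable_fun setT (g j).
  have [mf _] := sf j; have [mI _] := sI j.
  apply: measurable_funB; apply: measurable_funM;
    by [exact: measurableT_comp|exact: measurableT_comp].
have gle z : \sum_j g j z ^+ 2 <= K * gd s w z ^+ 2.
  have r0 : 0 <= K * gd s w z ^+ 2 by rewrite mulr_ge0// sqr_ge0.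
  rewrite (eq_bigr (fun j => \1_(Q j) z.1 * (\1_(Q j) z.2 * (w z.1 - w z.2) ^+ 2))).
    have [[j Qj]|nQ] := pselect (exists j, Q j z.1); last first.
      by rewrite sum_indic_eq0// => j Qj; apply: nQ; exists j.
    rewrite (sum_indic_eq Qd _ Qj) indicE; have [z2|] := boolP (_ \in _); last first.
      by rewrite mul0r.
    rewrite mul1r exprMn gk_sqr; rewrite inE in z2.
    have := KQ _ _ _ Qj z2; set e := eucl_norm _ => eK.
    have [e0|e0] := eqVneq e 0.
      have -> : z.1 = z.2.
        apply/eqP; rewrite -subr_eq0; apply/eqP/rowP => i; rewrite [RHS]mxE.
        move/eqP: e0; rewrite sqrtr_eq0 => h.
        have : (z.1 - z.2) ord0 i ^+ 2 <= 0.
          by apply: le_trans h; rewrite (bigD1 i)//= lerDl sumr_ge0// => *; rewrite sqr_ge0.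
        by rewrite le_eqVlt ltNge sqr_ge0 orbF sqrf_eq0 => /eqP.
      by rewrite subrr expr0n/= mul0r mulr0.
    have ep : 0 < e `^ (d%:R + 2 * s) by rewrite powR_gt0// lt_def e0 sqrtr_ge0.
    rewrite mulrCA ler_peMr ?sqr_ge0// -[leLHS](mulfV (lt0r_neq0 ep)).
    by rewrite ler_pM2r ?invr_gt0.
  move=> j _; rewrite gE !indicE.
  by case: (_ \in _); case: (_ \in _); rewrite ?mul1r ?mul0r ?expr0n ?mulr0.
have sg j : sqint leb2 (g j).
  apply: (@sqint_le _ _ _ _ _ (Num.sqrt K *: gd s w)) => //; last exact: sqintZ.
  move=> z; rewrite -ler_sqr ?nnegrE// -!normrX !ger0_norm ?sqr_ge0//.
  rewrite [leRHS](_ : _ = K * gd s w z ^+ 2); last by rewrite exprMn sqr_sqrtr.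
  by apply: le_trans (gle z); rewrite (bigD1 j)//= lerDl sumr_ge0// => *; rewrite sqr_ge0.
have ipg j : ip leb2 (g j) (g j) =
    2 * (vol * ip leb (f j) (f j) - ip leb w (\1_(Q j)) ^+ 2).
  by apply: EFin_inj; rewrite EFin_ip// lagrange_identity// volE fI.
have : \sum_j ip leb2 (g j) (g j) <= K * ip leb2 (gd s w) (gd s w).
  rewrite -lee_fin sum_ip// EFinM EFin_ip// -ge0_integralZl//.
  - apply: ge0_le_integral => //.
    + by move=> z _; rewrite lee_fin sumr_ge0// => *; rewrite sqr_ge0.
    + by apply/measurable_EFinP; apply: measurable_sum => j; exact: measurable_funX.
    + apply/measurable_EFinP; apply: measurable_funM => //.
      by apply: measurable_funX; case: gw.
    + by move=> z _; rewrite lee_fin.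
  - by apply/measurable_EFinP; apply: measurable_funX; case: gw.
  - by move=> z _; rewrite lee_fin sqr_ge0.
under eq_bigr do rewrite ipg.
rewrite -mulr_sumr big_split/= -mulr_sumr -wf sumrN.
lra.
Qed.

Lemma cube_partition (L delta : R) : 0 < L -> 0 < delta ->
  exists (I : finType) (Q : I -> set Rd) (h : R),
  [/\ 0 < h <= delta,
      forall (x : Rd) j j', Q j x -> Q j' x -> j = j',
      forall x : Rd, (forall i, `|x ord0 i| < L) -> exists j, Q j x,
      forall j, measurable (Q j) /\ leb (Q j) = (h ^+ d)%:E &
      forall j (x y : Rd), Q j x -> Q j y -> forall i, `|x ord0 i - y ord0 i| <= h].
Proof.
move=> L0 de0.
(* Adding one to the truncated quotient ensures [h <= delta]; the cells below are half-open so as to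
   be disjoint. *)
pose N := Num.truncn (2 * L / delta); pose h := 2 * L / N.+1%:R.
have h0 : 0 < h by rewrite divr_gt0// mulr_gt0.
have hN : N.+1%:R * h = 2 * L by rewrite mulrC divfK.
have hd : h <= delta.
  rewrite ler_pdivrMr// -ler_pdivrMl// mulrC; apply/ltW; exact: truncnS_gt.
pose J (j : {ffun 'I_d -> 'I_N.+1}) i : interval R :=
  `[- L + (j i)%:R * h, - L + (j i).+1%:R * h[.
exists {ffun 'I_d -> 'I_N.+1}, (fun j => [set x : Rd | forall i, x ord0 i \in J j i]), h.
have Jmul j i y : y \in J j i -> (j i)%:R * h <= y + L < (j i).+1%:R * h.
  by rewrite in_itv/= => /andP[? ?]; apply/andP; split; lra.
split.
- by rewrite h0.
- move=> x j j' /= Qj Qj'; apply/ffunP => i; apply/val_inj => /=.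
  have /andP[a1 a2] := Jmul _ _ _ (Qj i); have /andP[b1 b2] := Jmul _ _ _ (Qj' i).
  have := le_lt_trans a1 b2; have := le_lt_trans b1 a2.
  rewrite !ltr_pM2r// !ltr_nat !ltnS => ? ?.
  by apply/eqP; rewrite eqn_leq; apply/andP.
- move=> x xL; pose y i := (x ord0 i + L) / h.
  have y0 i : 0 <= y i.
    by rewrite divr_ge0 ?(ltW h0)//; have := xL i; rewrite ltr_norml => /andP[? _]; lra.
  have yN i : (Num.truncn (y i) < N.+1)%N.
    rewrite -(ltr_nat R); have /andP[yi _] := truncn_itv (y0 i).
    apply: le_lt_trans yi _.
    rewrite /y ltr_pdivrMr// hN; have := xL i; rewrite ltr_norml => /andP[_ ?]; lra.
  exists [ffun i => Ordinal (yN i)] => i; rewrite /J ffunE/= in_itv/=.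
  have /andP[] := truncn_itv (y0 i); rewrite /y ler_pdivlMr// ltr_pdivrMr//.
  by move=> ? ?; apply/andP; split; lra.
- move=> j; split; first exact: measurable_rV_box.
  rewrite lebesgue_rV_box (eq_bigr (fun=> h%:E)).
    by rewrite prodEFin prodr_const card_ord.
  move=> i _; rewrite (lebesgue_measure_itv (J j i)) /= lte_fin ltrD2l.
  rewrite ltr_pM2r// ltr_nat leqnn -EFinB; congr (_%:E).
  by rewrite -natr1; ring.
- move=> j x y /= Qx Qy i.
  have := Jmul _ _ _ (Qx i); have := Jmul _ _ _ (Qy i); rewrite -natr1.
  move=> /andP[? ?] /andP[? ?]; rewrite ler_norml; apply/andP; split; lra.
Qed.

(** Compactness of the segment gives a cluster point, and an ultrafilter converges to its cluster
    points. The same filter serves every cube and every mesh, where subsequences would have to be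
    extracted again. *)
Lemma ultra_bounded_cvg (G : set_system nat) (a : nat -> R) (B : R) :
  UltraFilter G -> (forall k, `|a k| <= B) ->
  exists l, forall eta, 0 < eta -> G [set k | `|a k - l| < eta].
Proof.
move=> UG aB; have PG : ProperFilter (a @ G) by exact: fmap_proper_filter.
have [|l [_ cl]] := @segment_compact R (- B) B (a @ G) PG.
  suff : G (a @^-1` `[- B, B]%classic) by [].
  by apply: filterS filterT => k _ /=; rewrite in_itv/= -ler_norml.
exists l => eta eta0.
have [//|Gn] := in_ultra_setVsetC [set k | `|a k - l| < eta] UG.
have [|_ [[k nk <-] kl]] := cl (a @` (~` [set k | `|a k - l| < eta])) (ball l eta) _
    (nbhsx_ballx _ _ eta0).
  suff : G (a @^-1` (a @` (~` [set k | `|a k - l| < eta]))) by [].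
  by apply: filterS Gn => k nk; exists k.
by exfalso; apply: nk; move: kl; rewrite /ball /= distrC.
Qed.

Lemma rellich (Omega : set Rd) (s L M : R) (u : nat -> Rd -> R) :
  0 < s -> 0 < L -> (forall x : Rd, Omega x -> forall i, `|x ord0 i| < L) ->
  (forall k, frac_space Omega s (u k)) -> (forall k, ip leb (u k) (u k) <= M) ->
  (forall k, ip leb2 (gd s (u k)) (gd s (u k)) <= M) ->
  exists phi : nat -> nat, (forall n, (n <= phi n)%N) /\
    forall n m, (n <= m)%N ->
      ip leb (u (phi n) - u (phi m)) (u (phi n) - u (phi m)) <= 8^-1 ^+ n.
Proof.
move=> s0 L0 OL Vu uM guM.
have M0 : 0 <= M by apply: le_trans (uM 0%N); exact: ip_ge0.
have [G [UG ooG]] := ultraFilterLemma eventually_filter.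
have s20 : 0 < 2 * s by rewrite mulr_gt0.
have p0 : 0 < d%:R + 2 * s by rewrite ltr_wpDl.
(* Points of a cube of side [h] are at most [sqrt d * h] apart, so the kernel's denominator is at
   most [C h^d h^(2 s)]. The factor [h^d] will cancel against the volume. *)
pose C := Num.sqrt d%:R `^ (d%:R + 2 * s); have C0 : 0 <= C by exact: powR_ge0.
have CM0 : 0 < C * M + 1 by rewrite ltr_wpDl// mulr_ge0.
have key e : 0 < e -> exists2 A, G A & forall k m, A k -> A m ->
    ip leb (u k - u m) (u k - u m) <= e.
  move=> e0.
  have b0 : 0 < e / (4 * (C * M + 1)) by rewrite divr_gt0// mulr_gt0.
  (* Differences of states have squared seminorm at most [4 M]. Per unit of volume their term is at
     most [2 C M h^(2 s)], and this mesh brings it below [e / 2]. *)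
  pose delta := (e / (4 * (C * M + 1))) `^ (2 * s)^-1.
  have de0 : 0 < delta by rewrite powR_gt0.
  have [I [Q [h [/andP[h0 hd] Qd QL mQ Qh]]]] := cube_partition L0 de0.
  have vol0 : 0 < h ^+ d by rewrite exprn_gt0.
  have hs : h `^ (2 * s) <= e / (4 * (C * M + 1)).
    rewrite [leRHS](_ : _ = delta `^ (2 * s)).
      by rewrite ge0_ler_powR// ?nnegrE// ltW.
    by rewrite -powRrM mulVf ?gt_eqF// powRr1// ltW.
  pose K := C * (h ^+ d * h `^ (2 * s)).
  have K0 : 0 <= K by rewrite !mulr_ge0 ?powR_ge0 ?(ltW vol0).
  have KQ j (x y : Rd) : Q j x -> Q j y -> eucl_norm (x - y) `^ (d%:R + 2 * s) <= K.
    move=> Qx Qy; have -> : K = (Num.sqrt d%:R * h) `^ (d%:R + 2 * s).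
      rewrite powRM ?sqrtr_ge0 ?(ltW h0)// /K /C [h `^ (d%:R + 2 * s)]powRD; last first.
        by rewrite gt_eqF// gt_eqF.
      by rewrite [h `^ d%:R]powR_mulrn ?ltW.
    have hE : Num.sqrt d%:R * h = Num.sqrt (d%:R * h ^+ 2).
      by rewrite sqrtrM// sqrtr_sqr ger0_norm// ltW.
    apply: ge0_ler_powR; rewrite ?nnegrE ?(ltW p0) ?sqrtr_ge0 ?mulr_ge0 ?sqrtr_ge0 ?(ltW h0)//.
    rewrite hE ler_wsqrtr//.
    apply: (@le_trans _ _ (\sum_(i < d) h ^+ 2)); last first.
      by rewrite sumr_const card_ord mulr_natl.
    apply: ler_sum => i _; rewrite !mxE -(real_normK (num_real (_ - _))).
    by rewrite lerXn2r ?nnegrE ?(ltW h0)//; exact: Qh Qx Qy i.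
  have mQ1 j : measurable (Q j) by have [] := mQ j.
  have mQ2 j : leb (Q j) = (h ^+ d)%:E by have [] := mQ j.
  have Qoo j : (leb (Q j) < +oo)%E by rewrite mQ2 ltry.
  have sI j := sqint_indic (mQ1 j) (Qoo j).
  have su k : sqint leb (u k) by case: (Vu k).
  have sgu k : sqint leb2 (gd s (u k)) by case: (Vu k).
  pose a j k := ip leb (u k) (\1_(Q j)).
  have aB j k : `|a j k| <= M * h ^+ d + 1.
    have : a j k ^+ 2 <= M * h ^+ d.
      apply: le_trans (ip_CS (su k) (sI j)) _.
      have -> : ip leb (\1_(Q j)) (\1_(Q j)) = h ^+ d.
        by apply: EFin_inj; exact: etrans (ip_indic (mQ1 j) (Qoo j)) (mQ2 j).
      by rewrite ler_wpM2r ?(ltW vol0).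
    rewrite -(real_normK (num_real (a j k))).
    have := normr_ge0 (a j k); have : 0 <= M * h ^+ d by rewrite mulr_ge0// ltW.
    set A := `|_|; nra.
  have /choice[l al] j : exists l, forall eta, 0 < eta -> G [set k | `|a j k - l| < eta].
    exact: ultra_bounded_cvg (aB j).
  (* Two selected states have integrals over each cube less than [2 sqrt B] apart, so the squares
     sum to at most [4 #|I| B <= h^d e / 2]. *)
  pose B := h ^+ d * e / (8 * (#|I|%:R + 1)).
  have B0 : 0 < B by rewrite divr_gt0 ?mulr_gt0// ltr_wpDl.
  exists [set k | forall j, `|a j k - l j| < Num.sqrt B].
    by apply: filter_forall => j; apply: al; rewrite sqrtr_gt0.
  move=> k m /= Ak Am; have Vw := frac_spaceB (Vu k) (Vu m).
  have QO x : Omega x -> exists j, Q j x by move=> Ox; apply: QL; exact: OL.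
  have p0' : d%:R + 2 * s != 0 by rewrite gt_eqF.
  have := partition_estimate Qd QO mQ1 mQ2 KQ K0 p0' Vw.
  set W := ip leb _ _ => WE.
  have sum_le : \sum_j ip leb (u k - u m) (\1_(Q j)) ^+ 2 <= h ^+ d * (e / 2).
    apply: (@le_trans _ _ (\sum_(j : I) 4 * B)).
      apply: ler_sum => j _; rewrite ipBl// -/(a j k) -/(a j m).
      have := Ak j; have := Am j; rewrite !ltr_norml => /andP[m1 m2] /andP[k1 k2].
      rewrite -(sqr_sqrtr (ltW B0)); set r := Num.sqrt B in m1 m2 k1 k2 *.
      have : - (2 * r) <= a j k - a j m <= 2 * r by apply/andP; split; lra.
      by move=> /andP[? ?]; nra.
    rewrite [leLHS](_ : _ = #|I|%:R * (4 * B)); last by rewrite sumr_const [RHS]mulr_natl.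
    rewrite /B.
    have I1 : 0 < #|I|%:R + 1 :> R by rewrite ltr_wpDl.
    have -> : #|I|%:R * (4 * (h ^+ d * e / (8 * (#|I|%:R + 1)))) =
        h ^+ d * (e / 2) * (#|I|%:R / (#|I|%:R + 1)) by field; rewrite gt_eqF.
    rewrite ler_piMr//; first by rewrite mulr_ge0 ?(ltW vol0)// divr_ge0// ltW.
    by rewrite ler_pdivrMr// mul1r lerDl.
  have gw_le : ip leb2 (gd s (u k - u m)) (gd s (u k - u m)) <= 4 * M.
    rewrite gdB; apply: le_trans (ip_subr_le (sgu k) (sgu m)) _.
    by have := guM k; have := guM m; lra.
  rewrite -(ler_pM2l vol0); apply: le_trans WE _.
  have : K / 2 * ip leb2 (gd s (u k - u m)) (gd s (u k - u m)) <= K / 2 * (4 * M).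
    by rewrite ler_wpM2l// divr_ge0.
  have : K / 2 * (4 * M) <= h ^+ d * (e / 2).
    have -> : K / 2 * (4 * M) = h ^+ d * (2 * (C * M) * h `^ (2 * s)).
      by rewrite /K; field.
    rewrite ler_pM2l//; apply: (@le_trans _ _ (2 * (C * M) * (e / (4 * (C * M + 1))))).
      by rewrite ler_wpM2l// !mulr_ge0.
    have -> : 2 * (C * M) * (e / (4 * (C * M + 1))) = e / 2 * ((C * M) / (C * M + 1)).
      by field; rewrite gt_eqF.
    rewrite ler_piMr ?divr_ge0 ?(ltW e0)//.
    by rewrite ler_pdivrMr// mul1r lerDl.
  move: sum_le; lra.
have /choice[A AP] n : exists A, G A /\ forall k m, A k -> A m ->
    ip leb (u k - u m) (u k - u m) <= 8^-1 ^+ n.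
  have [|A GA AP] := key (8^-1 ^+ n); last by exists A.
  by rewrite exprn_gt0// invr_gt0.
(* Lying in all of [A 0, ..., A n] at once puts both [phi n] and [phi m] in [A n] whenever
   [n <= m]. *)
have /choice[phi phiP] n : exists k, (n <= k)%N /\ forall i : 'I_n.+1, A i k.
  have : G [set k | (n <= k)%N /\ forall i : 'I_n.+1, A i k].
    apply: filterI; first by apply: ooG; exact: nbhs_infty_ge.
    by apply: filter_forall => i; have [] := AP i.
  by move=> /filter_ex[k kP]; exists k.
exists phi; split => [n|n m nm]; first by have [] := phiP n.
have [_ An] := phiP n; have [_ Am] := phiP m.
have [_] := AP n; apply; first exact: (An ord_max).
by have nm' : (n < m.+1)%N by []; exact: (Am (Ordinal nm')).
Qed.

End rellich.

(** * The optimal control problem *)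

Section square_integrable_cvg.
Context {dT : measure_display} {T : measurableType dT} {R : realType}.
Variable mu : {measure set T -> \bar R}.
Implicit Types f g h : T -> R.

Lemma cvg_ip (f_ : nat -> T -> R) f g : (forall n, sqint mu (f_ n)) ->
  sqint mu f -> sqint mu g ->
  (forall n, ip mu (f_ n - f) (f_ n - f) <= 8^-1 ^+ n) ->
  ip mu (f_ n) g @[n --> \oo] --> ip mu f g.
Proof.
move=> sf_ sf sg fr; set G := ip mu g g; have G0 : 0 <= G by exact: ip_ge0.
apply/subr_cvg0.
have le n : `|ip mu (f_ n) g - ip mu f g| <= (1 + G) * 2^-1 ^+ n.
  have a0 : 0 <= (1 + G) * 2^-1 ^+ n by rewrite mulr_ge0 ?addr_ge0 ?exprn_ge0 ?invr_ge0.
  rewrite -(ger0_norm a0) -ler_sqr ?nnegrE// -!normrX !ger0_norm ?sqr_ge0//.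
  rewrite -ipBl//; apply: le_trans (ip_CS (sqintB (sf_ n) sf) sg) _.
  apply: (@le_trans _ _ (8^-1 ^+ n * G)); first by rewrite ler_wpM2r.
  rewrite exprMn -exprM mulnC exprM mulrC; apply: ler_pM => //.
  - nra.
  - by rewrite lerXn2r ?nnegrE ?invr_ge0 ?exprn_ge0 ?invr_ge0//; lra.
apply: norm_cvg0; apply: (@squeeze_cvgr _ _ _ _ (fun=> 0) (fun n => (1 + G) * 2^-1 ^+ n)).
- by apply: nearW => n; rewrite normr_ge0 le.
- exact: cvg_cst.
- rewrite -(mulr0 (1 + G)); apply: cvgM; first exact: cvg_cst.
  by apply: cvg_expr; rewrite ger0_norm ?invr_ge0// invf_lt1 ?ltr1n.
Qed.

Lemma cvg_ip_diag (f_ : nat -> T -> R) f : (forall n, sqint mu (f_ n)) ->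
  sqint mu f -> (forall n, ip mu (f_ n - f) (f_ n - f) <= 8^-1 ^+ n) ->
  ip mu (f_ n) (f_ n) @[n --> \oo] --> ip mu f f.
Proof.
move=> sf_ sf fr.
have E n : ip mu (f_ n) (f_ n) =
    ip mu (f_ n - f) (f_ n - f) + 2 * ip mu (f_ n) f - ip mu f f.
  have sB := sqintB (sf_ n) sf.
  rewrite (ipBl (sf_ n) sf sB) (ipBr (sf_ n) sf (sf_ n)) (ipBr (sf_ n) sf sf).
  by rewrite (ipC mu f); ring.
under eq_fun do rewrite E.
suff : (ip mu (f_ n - f) (f_ n - f) + 2 * ip mu (f_ n) f - ip mu f f) @[n --> \oo]
    --> 0 + 2 * ip mu f f - ip mu f f.
  by rewrite (_ : 0 + _ - _ = ip mu f f)//; ring.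
apply: cvgB; last exact: cvg_cst.
apply: cvgD; last by apply: cvgM; [exact: cvg_cst|exact: cvg_ip].
apply: (@squeeze_cvgr _ _ _ _ (fun=> 0) (fun n => 8^-1 ^+ n)).
- by apply: nearW => n; rewrite ip_ge0 fr.
- exact: cvg_cst.
- exact: cvg_eighth.
Qed.

(** Both functions are limits of the same sequence; testing against [f - g] shows that its norm is
    zero. *)
Lemma ip_ae_eq (f_ : nat -> T -> R) f g : (forall n, sqint mu (f_ n)) ->
  sqint mu f -> sqint mu g ->
  (forall n, ip mu (f_ n - f) (f_ n - f) <= 8^-1 ^+ n) ->
  (forall n, ip mu (f_ n - g) (f_ n - g) <= 8^-1 ^+ n) ->
  {ae mu, forall x, f x = g x}.
Proof.
move=> sf_ sf sg ff fg; have sB := sqintB sf sg.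
have : {ae mu, forall x, (f - g) x = 0}.
  apply: ip_eq0_ae => //; rewrite (ipBl sf sg sB); apply/eqP; rewrite subr_eq0; apply/eqP.
  apply: (cvg_unique _ (cvg_ip sf_ sf sB ff)) => //.
  exact: (cvg_ip sf_ sg sB fg).
by apply: filterS => x; move/eqP; rewrite [_ == 0]subr_eq0 => /eqP.
Qed.

End square_integrable_cvg.

Section pointwise_evaluation.
Variables (R : realType) (T : Type).
Implicit Types f g : T -> R.

Lemma fun_scaleE k f x : (k *: f) x = k * f x. Proof. by []. Qed.

Lemma fun_addE f g x : (f + g) x = f x + g x. Proof. by []. Qed.

Lemma fun_subE f g x : (f - g) x = f x - g x. Proof. by []. Qed.

Lemma restrict_in (D : set T) f x : D x -> (f \_ D) x = f x.
Proof. by move=> Dx; rewrite patchE mem_set. Qed.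

Lemma restrict_out (D : set T) f x : ~ D x -> (f \_ D) x = 0.
Proof. by move=> nD; rewrite patchE memNset. Qed.

End pointwise_evaluation.

Section optimal_control.
Variables (R : realType) (d : nat).
Local Notation Rd := 'rV[R]_d.
Local Notation leb := (@lebesgue_rV R d).
Local Notation leb2 := (@lebesgue_rV R d \x @lebesgue_rV R d)%E.
Variables (Omega : set Rd) (s lambda a b : R) (f uOmega : Rd -> R).
Hypothesis oO : open Omega.
Hypothesis bO : bounded_set Omega.
Hypothesis lO : lipschitz_boundary Omega.
Hypothesis s01 : 0 < s < 1.
Hypothesis lambda0 : 0 < lambda.
Hypothesis a0 : 0 < a.
Hypothesis ab : a < b.
Hypothesis f2 : Lp Omega 2%:E f.
Hypothesis uOmega2 : Lp Omega 2%:E uOmega.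

Let mO : measurable Omega. Proof. exact: open_measurable_rV. Qed.
Let b0 : 0 < b. Proof. exact: lt_trans ab. Qed.
Let c := frac_lap_cst d s / 2.
Let c0 : 0 < c. Proof. by rewrite divr_gt0// frac_lap_cst_gt0. Qed.
Let F := f \_ Omega.
Let sF : sqint leb F. Proof. exact/sqint_LfunP. Qed.
Let U0 := uOmega \_ Omega.
Let sU0 : sqint leb U0. Proof. exact/sqint_LfunP. Qed.
Let VO := frac_space Omega s.
Let HV : Hs_tilde Omega s = VO.
Proof. by apply: Hs_tildeE => //; exact: lipschitz_boundary_negligible. Qed.

(** Representatives for which the bounds hold at every point of [Omega], so that products are
    estimated pointwise, and which vanish outside, so that integrals over R^d are integrals over
    [Omega]. *)
Definition Qad : set (Rd -> R) := [set q | [/\ measurable_fun setT q,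
  forall x, Omega x -> a <= q x <= b & forall x, ~ Omega x -> q x = 0]].

Let Qad_le q x : Qad q -> 0 <= q x <= b.
Proof.
move=> [_ qab q0]; have [Ox|nOx] := pselect (Omega x).
  by have /andP[aq ->] := qab x Ox; rewrite (le_trans (ltW a0) aq).
by rewrite q0// lexx ltW.
Qed.

Let Qad_norm q x : Qad q -> `|q x| <= b.
Proof. by move=> /Qad_le qb; have /andP[q0 qb'] := qb x; rewrite ger0_norm. Qed.

Let leO : (leb Omega < +oo)%E.
Proof. by have [M M0 OM] := coord_bounded_set bO; exact: lebesgue_rV_bounded OM. Qed.

Let sqint_Qad q : Qad q -> sqint leb q.
Proof.
move=> Qq; apply: (@sqint_le _ _ _ _ _ (b *: \1_Omega)).
- by case: Qq.
- move=> x; have [Ox|nOx] := pselect (Omega x).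
    rewrite [X in _ <= `|X|](_ : _ = b); first by rewrite (ger0_norm (ltW b0)) Qad_norm.
    by rewrite fun_scaleE indicE mem_set// mulr1.
  by have [_ _ ->] := Qq; rewrite ?normr0.
- by apply: sqintZ; exact: sqint_indic.
Qed.

Let mul_le q w x : Qad q -> `|(q \* w) x| <= `|(b *: w) x|.
Proof.
move=> Qq; rewrite fun_scaleE !normrM (ger0_norm (ltW b0)).
by rewrite ler_wpM2r// Qad_norm.
Qed.

Let sqint_Qmul q w : Qad q -> sqint leb w -> sqint leb (q \* w).
Proof.
move=> Qq sw; apply: (@sqint_le _ _ _ _ _ (b *: w)).
- by apply: measurable_funM; [case: Qq|case: sw].
- by move=> x; exact: mul_le.
- exact: sqintZ.
Qed.

Let ip_Qmul_le q w : Qad q -> sqint leb w ->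
  ip leb (q \* w) (q \* w) <= b ^+ 2 * ip leb w w.
Proof.
move=> Qq sw; apply: (@le_trans _ _ (ip leb (b *: w) (b *: w))).
  apply: ip_le; [exact: sqint_Qmul|exact: sqintZ|move=> x; exact: mul_le].
by rewrite (ipZl _ sw (sqintZ b sw)) (ipZr _ sw sw) mulrA.
Qed.

Let sV v : VO v -> sqint leb v. Proof. by case. Qed.
Let sgV v : VO v -> sqint leb2 (gd s v). Proof. by case. Qed.

Let state u q v := c * ip leb2 (gd s u) (gd s v) + ip leb (q \* u) v - ip leb F v.

Let feas u q := [/\ VO u, Qad q & forall v, VO v -> state u q v = 0].

Let J u q := 2^-1 * ip leb (u - U0) (u - U0) + lambda / 2 * ip leb q q.

Let L2innerE g v : VO v -> L2inner Omega g v = ip leb (g \_ Omega) v.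
Proof.
move=> [_ _ v0]; rewrite /L2inner Rintegral_mkcond; congr fine.
apply: eq_integral => x _; rewrite !patchE; case: ifPn => // _.
by rewrite mul0r.
Qed.

Let stateE u q v : VO u -> VO v ->
  frac_lap_form s u v + L2inner Omega (q \* u) v - L2inner Omega f v =
  state u (q \_ Omega) v.
Proof.
move=> [_ _ u0] Vv; rewrite frac_lap_formE !L2innerE// /state -/c -/F.
congr (_ + ip leb _ v - _); apply/funext => x; rewrite /= !patchE.
by case: ifPn => // _; rewrite mul0r.
Qed.

Let costE u q : VO u -> sqint leb (q \_ Omega) ->
  cost Omega lambda uOmega u q = J u (q \_ Omega).
Proof.
move=> Vu sq; have [su _ u0] := Vu.
have E : (u \- uOmega) \_ Omega = u - U0.
  apply/funext => x; rewrite fun_subE /U0.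
  have [Ox|nOx] := pselect (Omega x); first by rewrite !restrict_in.
  by rewrite !restrict_out// u0// subrr.
rewrite /cost /L2norm /J -E; congr (_ * _ + _ * _); apply: Lnorm2_sqr => //.
by rewrite E; exact: sqintB.
Qed.

Let Qad_patch q : Qad q -> q \_ Omega = q.
Proof.
move=> [_ _ q0]; apply/funext => x; rewrite patchE; case: ifPn => // /negP xO.
by rewrite q0// => Ox; apply: xO; rewrite inE.
Qed.

Let feas_feasible u q : feas u q -> feasible Omega s a b f u q.
Proof.
move=> [Vu Qq st]; split; first by rewrite HV.
- split; last by apply: nearW => x; have [_ + _] := Qq; apply.
  rewrite /Lp/= (Qad_patch Qq) inE; apply/andP; split; rewrite inE/=.
    by case: Qq.
  rewrite /finite_norm unlock; case: ifPn => // _.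
  apply: (@le_lt_trans _ _ b%:E); last exact: ltry.
  by apply/ess_supP; apply: nearW => x /=; rewrite lee_fin Qad_norm.
- move=> v; rewrite HV => Vv; apply/eqP; rewrite -subr_eq0; apply/eqP.
  by rewrite (stateE _ Vu Vv) (Qad_patch Qq) st.
Qed.

(* Redefining a control on a null set makes the box constraints hold everywhere. *)
Let feasible_feas u q : feasible Omega s a b f u q ->
  exists2 q', feas u q' & J u q' = cost Omega lambda uOmega u q.
Proof.
move=> [Vu [qoo qab] st]; rewrite HV in Vu.
have mq : measurable_fun setT (q \_ Omega).
  by move: qoo; rewrite /Lp/= inE => /andP[/[!inE]/= mq _].
pose p x := Num.max a (Num.min b ((q \_ Omega) x)).
pose q' := p \_ Omega.
have mq' : measurable_fun setT q'.
  have mp : measurable_fun setT p.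
    by apply: measurable_maxr => //; exact: measurable_minr.
  have [h _] := measurable_restrictT p mO.
  by apply: h; exact: measurable_funTS.
have Qq' : Qad q'.
  split=> // x Ox; last by rewrite /q' patchE memNset.
  rewrite /q' patchE mem_set// /p le_max lexx/= ge_max (ltW ab)/=.
  by rewrite ge_min lexx.
have qq' : {ae leb, forall x, (q \_ Omega) x = q' x}.
  apply: filterS qab => x qx; rewrite /q' /p !patchE; case: ifPn => // /set_mem Ox.
  have /andP[aq qb] := qx Ox.
  by rewrite min_r// max_r.
have sq : sqint leb (q \_ Omega).
  by apply: sqint_ae (sqint_Qad Qq') => //; apply: filterS qq' => x ->.
exists q'; last first.
  rewrite (costE Vu sq) /J; congr (_ + _ * _).
  have qq'' : {ae leb, forall x, q' x = (q \_ Omega) x} by apply: filterS qq' => x ->.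
  have sq' := sqint_Qad Qq'.
  by rewrite (ip_ae sq' sq sq' qq'') ipC (ip_ae sq' sq sq qq'').
split=> // v Vv; have := st v; rewrite HV => /(_ Vv) /eqP.
rewrite -subr_eq0 (stateE _ Vu Vv) => /eqP <-; congr (_ + _ - _).
have su := sV Vu.
apply: ip_ae; [exact: sqint_Qmul| |exact: sV|].
  apply: (@sqint_ae _ _ _ _ (q' \* u)); last exact: sqint_Qmul.
  - by apply: measurable_funM => //; case: su.
  - by apply: filterS qq' => x /= ->.
by apply: filterS qq' => x /= ->.
Qed.

(** Young's inequality, from the square of [a *: u - F]. The weight is such that the term in [u] is
    absorbed by the lower bound [a] of the controls. *)
Let ipF_le u : VO u -> 2 * ip leb F u <= a * ip leb u u + a^-1 * ip leb F F.
Proof.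
move=> Vu; have su := sV Vu; have sZ := sqintZ a su.
have := ip_ge0 leb (a *: u - F); have sB := sqintB sZ sF.
rewrite (ipBl sZ sF sB) (ipBr sZ sF sZ) (ipBr sZ sF sF).
rewrite (ipZl _ su sZ) (ipZr _ su su) (ipZr _ su sF) (ipZl _ su sF) (ipC leb u F) => h.
rewrite -(ler_pM2l a0) mulrDr mulrA (mulrA a a^-1) mulfV ?gt_eqF// mul1r; lra.
Qed.

(* Lax-Milgram for the constant control [a], by minimising the energy. *)
Let feas_exists : exists u q, feas u q.
Proof.
pose q0 : Rd -> R := cst a \_ Omega.
have Qq0 : Qad q0.
  split.
  - have [h _] := measurable_restrictT (cst a : Rd -> R) mO.
    by apply: h; exact: measurable_cst.
  - by move=> x Ox; rewrite /q0 patchE mem_set// lexx ltW.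
  - by move=> x nx; rewrite /q0 patchE memNset.
pose B u v := c * ip leb2 (gd s u) (gd s v) + a * ip leb u v.
pose E v := B v v - 2 * ip leb F v.
pose mid (x y : Rd -> R) := 2^-1 *: (x + y).
(* The factor [k] in the tolerances makes both terms of the defect, with their weights [c] and [a],
   yield the rate [8^-n]; the division by 8 offsets the 8 of [nested_minimisers]. *)
pose k := Num.min c a; have k0 : 0 < k by rewrite lt_min c0.
have e0 n : 0 < k * 8^-1 ^+ n / 8 by rewrite divr_gt0// mulr_gt0// exprn_gt0// invr_gt0.
have defect x y : VO x -> VO y -> 2 * E x + 2 * E y - 4 * E (mid x y) =
    c * ip leb2 (gd s (x - y)) (gd s (x - y)) + a * ip leb (x - y) (x - y).
  move=> Vx Vy; rewrite gdB -(ip_parallelogram (sV Vx) (sV Vy)).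
  rewrite -(ip_parallelogram (sgV Vx) (sgV Vy)) /E /B /mid gdZ gdD.
  rewrite (ipZr _ (sqintD (sV Vx) (sV Vy)) sF) (ipDr (sV Vx) (sV Vy) sF).
  by field.
have [x [l [Vx xC xl ly]]] : exists (x : nat -> Rd -> R) (l : R),
    [/\ forall n, VO (x n),
        forall n m, (n <= m)%N ->
          2 * E (x n) + 2 * E (x m) - 4 * E (mid (x n) (x m)) <= 8 * (k * 8^-1 ^+ n / 8),
        forall n, E (x n) <= l + k * 8^-1 ^+ n / 8 &
        forall n, exists2 m, (n <= m)%N & forall y, VO y -> l - k * 8^-1 ^+ n / 8 <= E y].
  apply: (@nested_minimisers _ _ (fun=> VO) mid E (- (a^-1 * ip leb F F)) 0
     (fun n => k * 8^-1 ^+ n / 8)) => //.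
  - by move=> n m _ y.
  - by move=> n y z Vy Vz; apply: frac_spaceZ; exact: frac_spaceD.
  - move=> _ y Vy; have := ipF_le Vy; rewrite /E /B.
    have : 0 <= c * ip leb2 (gd s y) (gd s y) by rewrite mulr_ge0 ?ip_ge0 ?ltW.
    lra.
  - move=> _; exists 0; first exact: frac_space0.
    have V00 := frac_space0 Omega s.
    rewrite /E /B -(scale0r (0 : Rd -> R)) gdZ.
    rewrite !(ipZr _ (sgV V00)) ?(ipZr _ (sV V00))//; last first.
    + by apply: sqintZ; exact: sgV.
    + by apply: sqintZ; exact: sV.
    by rewrite !mul0r !mulr0 addr0 subr0.
  - move=> n m nm; rewrite ler_pM2r// ler_wpM2l ?(ltW k0)//.
    by rewrite ler_wiXn2l ?invr_ge0// invf_le1 ?ler1n.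
have xC' n m : (n <= m)%N ->
    c * ip leb2 (gd s (x n - x m)) (gd s (x n - x m)) + a * ip leb (x n - x m) (x n - x m)
      <= k * 8^-1 ^+ n.
  by move=> /xC; rewrite defect//; lra.
have [||Vu ux gux] := @frac_space_complete _ _ Omega s x Vx.
- move=> n m /xC' h; rewrite -(ler_pM2l a0).
  apply: (@le_trans _ _ (k * 8^-1 ^+ n)).
    apply: le_trans h; rewrite lerDr mulr_ge0 ?ip_ge0 ?(ltW c0)//.
  by rewrite ler_wpM2r ?exprn_ge0 ?invr_ge0// ge_min lexx orbT.
- move=> n m /xC' h; rewrite -(ler_pM2l c0).
  apply: (@le_trans _ _ (k * 8^-1 ^+ n)).
    apply: le_trans h; rewrite lerDl mulr_ge0 ?ip_ge0 ?(ltW a0)//.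
  by rewrite ler_wpM2r ?exprn_ge0 ?invr_ge0// ge_min lexx.
set u := llim x in Vu ux gux.
exists u, q0; split=> // v Vv.
have -> : state u q0 v = B u v - ip leb F v.
  rewrite /state /B -(ipZl _ (sV Vu) (sV Vv)); congr (_ + ip leb _ v - _).
  apply/funext => y; rewrite fun_scaleE /q0 /=.
  have [Oy|nOy] := pselect (Omega y); first by rewrite restrict_in.
  by have [_ _ u0] := Vu; rewrite restrict_out// u0// mul0r mulr0.
set r := _ - _; set be := B v v.
have be0 : 0 <= be by rewrite addr_ge0// mulr_ge0 ?ip_ge0 ?ltW.
pose r_ n := B (x n) v - ip leb F v.
have cvgr : r_ n @[n --> \oo] --> r.
  apply: cvgB; last exact: cvg_cst.
  apply: cvgD; apply: cvgM; try exact: cvg_cst.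
    apply: cvg_ip => [n|||n]; [exact: sgV|exact: sgV|exact: sgV|].
    by rewrite -gdB; exact: gux.
  by apply: cvg_ip => // [n||]; exact: sV.
(* The first variation: [E (x n + t *: v)] is at least [l] and [E (x n)] at most [l], each up to
   [k 8^-n / 8], and [n] tends to infinity. *)
have pos t : 0 <= 2 * t * r + t ^+ 2 * be.
  have cv : 2 * t * r_ n + t ^+ 2 * be + k * 8^-1 ^+ n / 4 @[n --> \oo] -->
      2 * t * r + t ^+ 2 * be + k * 0 / 4.
    apply: cvgD; first by apply: cvgD; [apply: cvgM => //; exact: cvg_cst|exact: cvg_cst].
    apply: cvgM; last exact: cvg_cst.
    by apply: cvgM; [exact: cvg_cst|exact: cvg_eighth].
  rewrite mulr0 mul0r addr0 in cv.
  rewrite -(cvg_lim _ cv)//; apply: limr_ge; first by apply/cvg_ex; eexists; exact: cv.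
  apply: nearW => n; have [m nm lm] := ly n.
  have Vt := frac_spaceD (Vx n) (frac_spaceZ t Vv).
  have := lm _ Vt; have := xl n.
  have -> : E (x n + t *: v) = E (x n) + 2 * t * r_ n + t ^+ 2 * be.
    rewrite /E /r_ /be /B gdD gdZ.
    have sgx := sgV (Vx n); have sgv := sgV Vv; have sx := sV (Vx n); have sv := sV Vv.
    have sgt := sqintZ t sgv; have st := sqintZ t sv.
    rewrite (ipDl sgx sgt (sqintD sgx sgt)) (ipDr sgx sgt sgx) (ipDr sgx sgt sgt).
    rewrite (ipZl _ sgv sgt) (ipZr _ sgv sgv) (ipZr _ sgv sgx) (ipZl _ sgv sgx).
    rewrite (ipDl sx st (sqintD sx st)) (ipDr sx st sx) (ipDr sx st st).
    rewrite (ipZl _ sv st) (ipZr _ sv sv) (ipZr _ sv sx) (ipZl _ sv sx).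
    rewrite (ipDr sx st sF) (ipZr _ sv sF).
    rewrite (ipC leb2 (gd s v) (gd s (x n))) (ipC leb v (x n)); ring.
  lra.
(* Using [be + 1] for [be] in the optimal [t] covers the case [be = 0] and still forces [r = 0]. *)
have := pos (- r / (be + 1)).
have be1 : 0 < be + 1 by rewrite ltr_wpDl.
have -> : 2 * (- r / (be + 1)) * r + (- r / (be + 1)) ^+ 2 * be =
    - (r ^+ 2 * (be + 2)) / (be + 1) ^+ 2 by field; rewrite gt_eqF.
rewrite pmulr_lge0 ?invr_gt0 ?exprn_gt0// oppr_ge0 => h.
apply/eqP; rewrite -sqrf_eq0 eq_le sqr_ge0 andbT.
by move: h; rewrite pmulr_lle0// ltr_wpDl.
Qed.

(** The product of [u] and [v] is merely integrable, so L^2 convergence of the controls cannot be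
    paired with it directly; their common bound [b] gives the majorant [b |u v|]. *)
Let cvg_control (q_ : nat -> Rd -> R) q u v : (forall n, Qad (q_ n)) -> Qad q ->
  {ae leb, forall x, q_ n x @[n --> \oo] --> q x} -> sqint leb u -> sqint leb v ->
  ip leb (q_ n \* u) v @[n --> \oo] --> ip leb (q \* u) v.
Proof.
move=> Qq_ Qq qq su sv.
have i_ n := sqint_mul (sqint_Qmul (Qq_ n) su) sv.
have i := sqint_mul (sqint_Qmul Qq su) sv.
have ib := integrable_abse (sqint_mul (sqintZ b su) sv).
have [|||||_ _ cv] := @dominated_convergence _ _ _ leb setT measurableT
   (fun n x => ((q_ n \* u) x * v x)%:E) (fun x => ((q \* u) x * v x)%:E)
   (fun x => `|((b *: u) x * v x)%:E|%E).
- by move=> n; have /integrableP[] := i_ n.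
- by have /integrableP[] := i.
- apply: filterS qq => x qx _; apply: cvg_EFin; first exact: nearW.
  apply: (@cvgM _ _ _ _ (fun n => (q_ n \* u) x)); last exact: cvg_cst.
  by apply: cvgM => //; exact: cvg_cst.
- exact: ib.
- apply: nearW => x n _; rewrite lee_fin normrM [leRHS]normrM ler_wpM2r//.
  exact: mul_le.
apply: fine_cvg; rewrite fineK; first exact: cv.
exact: integrable_fin_num.
Qed.

Lemma optimal_control_exists :
  exists u q, global_solution Omega s lambda a b f uOmega u q.
Proof.
pose S := [set J p.1 p.2 | p in [set p : (Rd -> R) * (Rd -> R) | feas p.1 p.2]].
have J0 u q : 0 <= J u q by rewrite addr_ge0// mulr_ge0 ?ip_ge0// ?invr_ge0// divr_ge0// ltW.
have S0 : S !=set0.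
  by have [u [q uq]] := feas_exists; exists (J u q), (u, q).
have lbS : has_lbound S by exists 0 => _ [p _ <-]; exact: J0.
pose j := inf S; have jle u q : feas u q -> j <= J u q.
  by move=> uq; apply: ge_inf => //; exists (u, q).
have e8 n : 0 < 8^-1 ^+ n :> R by rewrite exprn_gt0// invr_gt0.
have e8le n m : (n <= m)%N -> 8^-1 ^+ m <= 8^-1 ^+ n :> R.
  by move=> nm; rewrite ler_wiXn2l ?invr_ge0// invf_le1 ?ler1n.
have /choice[w wP] n : exists p : (Rd -> R) * (Rd -> R),
    feas p.1 p.2 /\ J p.1 p.2 <= j + 8^-1 ^+ n.
  have [_ [p fp <-] /ltW Jp] := inf_adherent (e8 n) (conj S0 lbS).
  by exists p.
(* With [K = ip leb F F / (2 * a)], the energy estimate bounds the squared norm by [K * (2 / a)] and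
   the squared seminorm by [K / c]; [M] is their sum. *)
pose M := ip leb F F / (2 * a) * (c^-1 + 2 / a).
have ipFF : 0 <= ip leb F F by exact: ip_ge0.
have energy u q : feas u q ->
    c * ip leb2 (gd s u) (gd s u) + a / 2 * ip leb u u <= ip leb F F / (2 * a).
  move=> [Vu Qq /(_ u Vu)]; have su := sV Vu.
  have : a * ip leb u u <= ip leb (q \* u) u.
    rewrite -ipZl//; apply: le_Rintegral => //.
    - exact: sqint_mul (sqintZ a su) su.
    - exact: sqint_mul (sqint_Qmul Qq su) su.
    move=> x _; rewrite fun_scaleE /= -!mulrA -expr2.
    have [Ox|nOx] := pselect (Omega x).
      by rewrite ler_wpM2r ?sqr_ge0//; have [_ /(_ x Ox)/andP[]] := Qq.
    by have [_ _ ->] := Vu; rewrite // expr0n !mulr0.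
  have := ipF_le Vu; rewrite /state.
  have -> : ip leb F F / (2 * a) = 2^-1 * (a^-1 * ip leb F F) by field; rewrite gt_eqF.
  lra.
have boundM u q : feas u q ->
    ip leb u u <= M /\ ip leb2 (gd s u) (gd s u) <= M.
  move=> /energy h; set K := ip leb F F / (2 * a) in h.
  have K0 : 0 <= K by rewrite divr_ge0// mulr_ge0// ltW.
  have g0 := ip_ge0 leb2 (gd s u); have u0 := ip_ge0 leb u.
  have -> : M = K / c + K * (2 / a) by rewrite /M mulrDr.
  split.
    apply: (@le_trans _ _ (K * (2 / a))); last by rewrite lerDr divr_ge0// ltW.
    rewrite -(ler_pM2l (divr_gt0 a0 (@ltr0n R 2))).
    have -> : a / 2 * (K * (2 / a)) = K by field; rewrite gt_eqF.
    by apply: le_trans h; rewrite lerDr mulr_ge0// ltW.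
  apply: (@le_trans _ _ (K / c)); last by rewrite lerDl mulr_ge0// divr_ge0// ltW.
  rewrite ler_pdivlMr// mulrC; apply: le_trans h.
  by rewrite lerDl mulr_ge0// divr_ge0// ltW.
have [L L0 OL] := coord_bounded_set bO.
have s0 : 0 < s by case/andP: s01.
have Vw n : VO (w n).1 by have [[]] := wP n.
have [phi [lephi phiC]] := rellich s0 L0 OL Vw
  (fun n => (boundM _ _ (wP n).1).1) (fun n => (boundM _ _ (wP n).1).2).
pose u_ n := (w (phi n)).1; pose q_ n := (w (phi n)).2.
have Vu_ n : VO (u_ n) by exact: Vw.
have su_ n := sV (Vu_ n).
have Qq_ n : Qad (q_ n) by have [[]] := wP (phi n).
have [_ suoo uuoo] := fast_cauchy_llim su_ phiC.
set uoo := llim _ in suoo uuoo.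
pose X U Q v := c * ip leb2 (gd s U) (gd s v) + ip leb (Q \* uoo) v - ip leb F v.
(* The product of control and state is made affine in [(U, Q)] by freezing the
   state at its strong limit [uoo]; this is what makes [C n] convex. *)
pose C n : set ((Rd -> R) * (Rd -> R)) := [set p |
  [/\ VO p.1 /\ Qad p.2,
      ip leb (p.1 - uoo) (p.1 - uoo) <= 8^-1 ^+ n,
      forall v, VO v -> X p.1 p.2 v ^+ 2 <= b ^+ 2 * 8^-1 ^+ n * ip leb v v &
      J p.1 p.2 <= j + 8^-1 ^+ n]].
pose mid (x y : (Rd -> R) * (Rd -> R)) : (Rd -> R) * (Rd -> R) :=
  (2^-1 *: (x.1 + y.1), 2^-1 *: (x.2 + y.2)).
pose N (p : (Rd -> R) * (Rd -> R)) :=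
  ip leb p.1 p.1 + ip leb2 (gd s p.1) (gd s p.1) + ip leb p.2 p.2.
have Cw n : C n (u_ n, q_ n).
  have [[Vu Qq st] Jle] := wP (phi n).
  split=> //=; last by apply: le_trans Jle _; rewrite lerD2l e8le.
  move=> v Vv; have sd := sqintB suoo (su_ n).
  (* Subtracting the state equation of the pair leaves only the error made by freezing the state. *)
  have -> : X (u_ n) (q_ n) v = ip leb (q_ n \* (uoo - u_ n)) v.
    rewrite (_ : q_ n \* (uoo - u_ n) = q_ n \* uoo - q_ n \* u_ n); last first.
      by apply/funext => x; rewrite fun_subE /= fun_subE mulrBr.
    rewrite ipBl//; [|exact: sqint_Qmul|exact: sqint_Qmul|exact: sV].
    have : state (u_ n) (q_ n) v = 0 by exact: st.
    rewrite /X /state; set A1 := _ * _; set A2 := ip leb (q_ n \* u_ n) v.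
    set A3 := ip leb F v; set A4 := ip leb _ v; lra.
  apply: le_trans (ip_CS (sqint_Qmul (Qq_ n) sd) (sV Vv)) _.
  rewrite ler_wpM2r ?ip_ge0//; apply: le_trans (ip_Qmul_le (Qq_ n) sd) _.
  rewrite ler_wpM2l ?sqr_ge0//; apply: le_trans (uuoo n).
  rewrite -[uoo - _]opprB -scaleN1r (ipZl _ (sqintB (su_ n) suoo)); last first.
    by apply: sqintZ; exact: sqintB.
  rewrite (ipZr _ (sqintB (su_ n) suoo) (sqintB (su_ n) suoo)).
  by rewrite mulrA mulrNN mulr1 mul1r.
have Cmid n x y : C n x -> C n y -> C n (mid x y).
  case: x y => [U Q] [U' Q'] [/= [VU QQ] dU XU JU] [/= [VU' QQ'] dU' XU' JU'].
  have sU := sV VU; have sU' := sV VU'; have sQ := sqint_Qad QQ; have sQ' := sqint_Qad QQ'.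
  have Vm : VO (2^-1 *: (U + U')) by apply: frac_spaceZ; exact: frac_spaceD.
  split=> /=.
  - split=> //; have [mQ Qab Q0] := QQ; have [mQ' Qab' Q0'] := QQ'; split.
    + by apply: measurable_funM => //; exact: measurable_funD.
    + move=> x Ox; have /andP[h1 h2] := Qab x Ox; have /andP[h3 h4] := Qab' x Ox.
      rewrite fun_scaleE fun_addE; apply/andP; split; lra.
    + move=> x nx; rewrite fun_scaleE fun_addE Q0// Q0'//.
      by rewrite addr0 mulr0.
  - rewrite mid_subr; apply: ip_mid_le => //; exact: sqintB.
  (* [X] is affine in the pair, so its square is convex and its bound passes to midpoints. *)
  - move=> v Vv; have XE : X (2^-1 *: (U + U')) (2^-1 *: (Q + Q')) v =
      2^-1 * (X U Q v + X U' Q' v).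
      rewrite /X gdZ gdD (ipZl _ (sqintD (sgV VU) (sgV VU')) (sgV Vv)).
      rewrite (ipDl (sgV VU) (sgV VU') (sgV Vv)).
      have -> : (2^-1 *: (Q + Q')) \* uoo = 2^-1 *: (Q \* uoo + Q' \* uoo).
        have H (x y z : R) : 2^-1 * (x + y) * z = 2^-1 * (x * z + y * z) by ring.
        by apply/funext => x; exact: H.
      have h1 := sqint_Qmul QQ suoo; have h2 := sqint_Qmul QQ' suoo.
      rewrite (ipZl _ (sqintD h1 h2) (sV Vv)) (ipDl h1 h2 (sV Vv)).
      by field.
    have := XU v Vv; have := XU' v Vv; rewrite XE.
    by have := sqr_ge0 (X U Q v - X U' Q' v); nra.
  - rewrite /J; have m1 := sqintB sU sU0; have m2 := sqintB sU' sU0.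
    rewrite mid_subr; move: JU JU'; rewrite /J.
    have := ip_parallelogram m1 m2; have := ip_parallelogram sQ sQ'.
    have := ip_ge0 leb ((U - U0) - (U' - U0)); have := ip_ge0 leb (Q - Q').
    set A1 := ip leb (_ *: _) _; set A2 := ip leb (_ *: _) _.
    by move=> ? ? ? ? ? ?; have := ltW lambda0; nra.
have [p [l [Cp pC _ _]]] : exists (p : nat -> (Rd -> R) * (Rd -> R)) (l : R),
    [/\ forall n, C n (p n),
        forall n m, (n <= m)%N ->
          2 * N (p n) + 2 * N (p m) - 4 * N (mid (p n) (p m)) <= 8 * (8^-1 ^+ n / 8),
        forall n, N (p n) <= l + 8^-1 ^+ n / 8 &
        forall n, exists2 m, (n <= m)%N & forall y, C m y -> l - 8^-1 ^+ n / 8 <= N y].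
  (* The upper bound is for [N] at [(u_ n, q_ n)]: [M] twice for the state, and for the control
     [lambda / 2] times its squared norm is at most the cost, hence at most [j + 1]. *)
  apply: (@nested_minimisers _ _ C mid N 0 (M + M + 2 / lambda * (j + 1))
     (fun n => 8^-1 ^+ n / 8)) => //.
  - move=> n m nm y [? dy Xy Jy]; split=> //.
    + exact: le_trans dy (e8le _ _ nm).
    + move=> v Vv; apply: le_trans (Xy v Vv) _.
      by rewrite ler_wpM2r ?ip_ge0// ler_wpM2l ?sqr_ge0// e8le.
    + by apply: le_trans Jy _; rewrite lerD2l e8le.
  - by move=> n y _; rewrite !addr_ge0 ?ip_ge0.
  - move=> n; exists (u_ n, q_ n); first exact: Cw.
    have [h1 h2] := boundM _ _ (wP (phi n)).1; rewrite /N /= !lerD//.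
    have [_ _ _ /=] := Cw n; rewrite /J => hJ.
    have := ip_ge0 leb (u_ n - U0); have : 8^-1 ^+ n <= 1 :> R by exact: (e8le 0%N).
    move=> h3 h4; rewrite -ler_pdivrMl ?divr_gt0// invf_div mulrC; lra.
  - by move=> n m nm; rewrite ler_pM2r ?e8le.
have Vp n : VO (p n).1 by have [[]] := Cp n.
have Qp n : Qad (p n).2 by have [[]] := Cp n.
have sp n := sV (Vp n); have sgp n := sgV (Vp n); have sqp n := sqint_Qad (Qp n).
have pC' n m : (n <= m)%N -> [/\
    ip leb ((p n).1 - (p m).1) ((p n).1 - (p m).1) <= 8^-1 ^+ n,
    ip leb2 (gd s ((p n).1 - (p m).1)) (gd s ((p n).1 - (p m).1)) <= 8^-1 ^+ n &
    ip leb ((p n).2 - (p m).2) ((p n).2 - (p m).2) <= 8^-1 ^+ n].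
  (* The defect of [N] is a sum of three squared distances, each of which is at most the total. *)
  have split3 (x1 y1 m1 x2 y2 m2 x3 y3 m3 D1 D2 D3 e : R) :
      0 <= D1 -> 0 <= D2 -> 0 <= D3 ->
      2 * x1 + 2 * y1 - 4 * m1 = D1 -> 2 * x2 + 2 * y2 - 4 * m2 = D2 ->
      2 * x3 + 2 * y3 - 4 * m3 = D3 ->
      2 * (x1 + x2 + x3) + 2 * (y1 + y2 + y3) - 4 * (m1 + m2 + m3) <= 8 * (e / 8) ->
      [/\ D1 <= e, D2 <= e & D3 <= e].
    by move=> *; split; lra.
  move=> /pC; rewrite /N /mid /= gdZ gdD gdB.
  exact: (split3 _ _ _ _ _ _ _ _ _ _ _ _ _ (ip_ge0 _ _) (ip_ge0 _ _) (ip_ge0 _ _)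
    (ip_parallelogram (sp n) (sp m)) (ip_parallelogram (sgp n) (sgp m))
    (ip_parallelogram (sqp n) (sqp m))).
have [||Vu pu gpu] := @frac_space_complete _ _ Omega s (fun n => (p n).1) Vp.
- by move=> n m /pC'[].
- by move=> n m /pC'[].
set u := llim _ in Vu pu gpu.
have [|aeq sq pq] := fast_cauchy_llim sqp; first by move=> n m /pC'[].
set q := llim _ in aeq sq pq.
have Qq : Qad q.
  split; first by case: sq.
  - by move=> x Ox; apply: llim_itv => n; have [_ + _] := Qp n; apply.
  - move=> x nx; apply: cvg_llim.
    rewrite (_ : (fun n => _) = cst 0); first exact: cvg_cst.
    by apply/funext => n; have [_ _ ->] := Qp n.
have su := sV Vu.
(* The states of [p n] converge to both, so freezing at [uoo] is exact in the limit and the limit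
   pair solves the true equation. *)
have uu : {ae leb, forall x, uoo x = u x}.
  apply: (ip_ae_eq sp suoo su _ pu) => n; by have [_ h _ _] := Cp n.
have st v : VO v -> state u q v = 0.
  move=> Vv; have sv := sV Vv.
  have -> : state u q v = X u q v.
    rewrite /state /X; congr (_ + _ - _).
    apply: (ip_ae (sqint_Qmul Qq su) (sqint_Qmul Qq suoo) sv).
    by apply: filterS uu => x /= ->.
  have cX : X (p n).1 (p n).2 v @[n --> \oo] --> X u q v.
    apply: cvgB; last exact: cvg_cst.
    apply: cvgD; last exact: cvg_control.
    apply: cvgM; first exact: cvg_cst.
    apply: cvg_ip => // [||n]; [exact: sgV|exact: sgV|].
    by rewrite -gdB; exact: gpu.
  have cX2 : X (p n).1 (p n).2 v ^+ 2 @[n --> \oo] --> (0 : R).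
    apply: (@squeeze_cvgr _ _ _ _ (fun=> 0)
      (fun n => b ^+ 2 * 8^-1 ^+ n * ip leb v v)).
    - by apply: nearW => n; rewrite sqr_ge0/=; have [_ _ + _] := Cp n; apply.
    - exact: cvg_cst.
    - rewrite -[X in _ --> X](mul0r (ip leb v v)); apply: cvgM; last exact: cvg_cst.
      rewrite -(mulr0 (b ^+ 2)); apply: cvgM; first exact: cvg_cst.
      exact: cvg_eighth.
  apply/eqP; rewrite -sqrf_eq0; apply/eqP.
  exact: (cvg_unique _ (cvgM cX cX) cX2).
exists u, q; split; first by exact: feas_feasible.
(* A competitor costs as much as an everywhere admissible one, hence at least [j], while [J] along
   [p] is at most [j + 8^-n] and converges to the cost of the limit. *)
move=> u' q' /feasible_feas[q'' fq'' <-].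
rewrite costE ?(Qad_patch Qq)//; apply: le_trans (jle _ _ fq'').
have cJ : J (p n).1 (p n).2 @[n --> \oo] --> J u q.
  apply: cvgD; apply: cvgM; try exact: cvg_cst; last exact: cvg_ip_diag.
  apply: cvg_ip_diag => [n||n]; [exact: sqintB|exact: sqintB|].
  by rewrite opprB addrA subrK; exact: pu.
have cj : j + 8^-1 ^+ n @[n --> \oo] --> j.
  by rewrite -[X in _ --> X]addr0; apply: cvgD; [exact: cvg_cst|exact: cvg_eighth].
rewrite -(cvg_lim _ cJ)// -(cvg_lim _ cj)//.
apply: ler_lim; [by apply/cvg_ex; eexists; exact: cJ|
  by apply/cvg_ex; eexists; exact: cj|].
by apply: nearW => n; have [] := Cp n.
Qed.

End optimal_control.

Theorem theorem4p1 (R : realType) (d : nat) (Omega : set 'rV[R]_d)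
    (s lambda a b : R) (f uOmega : 'rV[R]_d -> R) :
  (2 <= d)%N ->
  domain Omega -> bounded_set Omega -> lipschitz_boundary Omega ->
  0 < s < 1 -> 0 < lambda -> 0 < a -> a < b ->
  Lp Omega 2%:E f -> Lp Omega 2%:E uOmega ->
  exists u q : 'rV[R]_d -> R,
    global_solution Omega s lambda a b f uOmega u q.
Proof.
move=> _ [oO _ _] bO lO s01 lambda0 a0 ab f2 uOmega2.
exact: optimal_control_exists.
Qed.
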